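(* Let $n\ge1$ and $p\ge 1$ be integers, let $a\ge 1$ be a real constant with $2p<n+2a$, and let $\alpha>1$. Let $u\in C^{2p}(\mathbb R^{n+1})$ with $u>0$ be even with respect to $x_{n+1}$ and satisfy $$(-\widetilde\Delta_{n+1,a})^p u=u^{\alpha}\quad\text{in }\mathbb R^{n+1}.$$ Then $$(-\widetilde\Delta_{n+1,a})^i u>0\quad\text{in }\mathbb R^{n+1},\qquad i=1,\dots,p-1 .$$
   Context: $\widetilde\Delta_{n+1,a}=\sum_{i=1}^{n+1}\partial_{x_i}^2+\frac{2a-1}{x_{n+1}}\partial_{x_{n+1}}$. It is applied to functions even in $x_{n+1}$, i.e. $u(x',x_{n+1})=u(x',-x_{n+1})$ with $x'=(x_1,\dots,x_n)$; at points with $x_{n+1}=0$ the term $\frac{1}{x_{n+1}}\partial_{x_{n+1}}u$ is understood as its continuous extension $\partial_{x_{n+1}}^2u$. For $u\in C^{2p}$ even in $x_{n+1}$, $\widetilde\Delta_{n+1,a}u$ is again even in $x_{n+1}$ and of class $C^{2p-2}$, so the powers are obtained by iteration. *)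

(* Defs.v *)
From HB Require Import structures.
From mathcomp Require Import all_boot all_order all_algebra.
From mathcomp Require Import all_classical all_reals all_analysis.

Set Implicit Arguments.
Unset Strict Implicit.
Unset Printing Implicit Defensive.
Import Order.TTheory GRing.Theory Num.Theory.
Import numFieldNormedType.Exports.
Local Open Scope classical_set_scope.
Local Open Scope ring_scope.

(* A point of the (n+1)-dimensional space is a row vector x : 'rV[R]_n.+1;
   its distinguished last coordinate is x 0 ord_max. *)

Definition basis_vec (R : realType) (n : nat) (i : 'I_n.+1) : 'rV[R]_n.+1 :=
  delta_mx 0 i.

Definition partial (R : realType) (n : nat) (i : 'I_n.+1)
    (f : 'rV[R]_n.+1 -> R) : 'rV[R]_n.+1 -> R :=
  fun x => 'D_(basis_vec R i) f x.

(* C^k on the whole space: all iterated partial derivatives of order at most k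
   exist and are continuous. *)
Fixpoint class_C (R : realType) (n : nat) (k : nat)
    (f : 'rV[R]_n.+1 -> R) : Prop :=
  if k is k'.+1 then
    continuous f /\
    forall i : 'I_n.+1,
      (forall x, derivable f x (basis_vec R i)) /\ class_C k' (partial i f)
  else continuous f.

Definition reflect_last (R : realType) (n : nat) (x : 'rV[R]_n.+1) :
    'rV[R]_n.+1 :=
  \row_i (if i == ord_max then - x 0 i else x 0 i).

Definition even_last (R : realType) (n : nat) (f : 'rV[R]_n.+1 -> R) : Prop :=
  forall x, f (reflect_last x) = f x.

(* (1 / x_{n+1}) d_{n+1} f, with its continuous extension d_{n+1}^2 f on the
   hyperplane x_{n+1} = 0 (f being C^2 and even in the last variable). *)
Definition singular_term (R : realType) (n : nat) (f : 'rV[R]_n.+1 -> R) :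
    'rV[R]_n.+1 -> R :=
  fun x => if x 0 ord_max == 0 then partial ord_max (partial ord_max f) x
           else (x 0 ord_max)^-1 * partial ord_max f x.

Definition weighted_laplacian (R : realType) (n : nat) (a : R)
    (f : 'rV[R]_n.+1 -> R) : 'rV[R]_n.+1 -> R :=
  fun x => \sum_(i < n.+1) partial i (partial i f) x
           + (2 * a - 1) * singular_term f x.

Definition neg_weighted_laplacian_pow (R : realType) (n : nat) (a : R)
    (k : nat) (f : 'rV[R]_n.+1 -> R) : 'rV[R]_n.+1 -> R :=
  iter k (fun g x => - weighted_laplacian a g x) f.

(* Main.v *)
Require Import Defs.
From HB Require Import structures.
From mathcomp Require Import all_boot all_order all_algebra.
From mathcomp Require Import all_classical all_reals all_analysis.
From mathcomp Require Import ring lra.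

Set Implicit Arguments.
Unset Strict Implicit.
Unset Printing Implicit Defensive.
Import Order.TTheory GRing.Theory Num.Theory.
Import numFieldNormedType.Exports.
Local Open Scope classical_set_scope.
Local Open Scope ring_scope.

(** Write L for the weighted Laplacian, y for the last coordinate, b = 2a - 1
and v_i = (-L)^i u.  Since L is symmetric for the density |y|^b, it behaves
like the Laplacian of a space of dimension Q = n + 2a, acting on functions that
see the last 2a coordinates only through their length.

Averages.  Fix a center c with c_y >= 0 and a radius r.  Put
s(x, theta) = |x - c|^2 + 2 y c_y (1 - cos theta), a squared distance in that
larger space, and bump = max(0, 1 - s / r^2).  Let T_k f be the integral of
bump^(k+1) f y^b (sin theta)^(b-1) over x and theta ([kernel_mean]).
Integrating over theta is the generalized translation of the Bessel operator,
which is what allows a center off the hyperplane y = 0.  Integration by parts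
([green_identity]) turns L into a three-term relation between consecutive
exponents,
  r^2 / (2(k+3)) T_(k+2)(L f) = 2(k+2) T_k f - (2(k+2) + Q) T_(k+1) f,
and the case f = 1 computes the ratios of the total masses T_k 1 ([massE]).
Two consequences carry the proof.
- If L f <= 0, the averages T_k f / T_k 1 increase with k; since bump^k
  concentrates at c while T_k 1 decays only polynomially, they tend to f(c), so
  they are at most f(c) ([kernel_mean_le_center]).
- Solving the relation for T_(k+2)(L f) and iterating gives
  |T_(j+2i) v_i| <= C r^(-2i) T_j u with C independent of r
  ([kernel_mean_iterate]).  For i = p the left-hand side is T_(j+2p) u^alpha,
  and Young's inequality, with j so large that the powers of bump match,
  absorbs T_j u: hence T_j u / T_0 1 tends to 0 as r grows
  ([kernel_mean_vanishes]), and so do the averages of every v_i.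

Conclusion.  Descend from v_p = u^alpha > 0.  If v_(i+1) > 0 then L v_i < 0, so
v_i(c) is at least an average of v_i that tends to 0, whence v_i >= 0; a zero
of v_i would be a minimum, where L v_i >= 0 ([laplacian_at_min]), so v_i > 0.

Tools.  The integrals are used only through positivity, linearity and the
fundamental theorem of calculus in one coordinate at a time, for continuous
functions on a box; an ultralimit of Riemann sums has these three properties
without any measure theory, because finite sums commute ([mean_partial]).
The iterates v_i must be shown regular across y = 0: for f even in y,
f_y / y is the mean of f_yy(x', t y) over t in [0, 1], which has as many
derivatives as f_yy ([class_C_laplacian]). *)

(** * Continuity and ultralimits *)

Section ContinuousFunctions.
Context {R : realType} {T : topologicalType}.
Implicit Types f g : T -> R.

Lemma continuous_funD f g :
  continuous f -> continuous g -> continuous (fun x => f x + g x).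
Proof. by move=> cf cg x; exact: (continuousD (cf x) (cg x)). Qed.

Lemma continuous_funN f : continuous f -> continuous (fun x => - f x).
Proof. by move=> cf x; exact: (continuousN (cf x)). Qed.

Lemma continuous_funB f g :
  continuous f -> continuous g -> continuous (fun x => f x - g x).
Proof. by move=> cf cg; apply/continuous_funD/continuous_funN. Qed.

Lemma continuous_funM f g :
  continuous f -> continuous g -> continuous (fun x => f x * g x).
Proof. by move=> cf cg x; exact: (continuousM (cf x) (cg x)). Qed.

Lemma continuous_funX f k : continuous f -> continuous (fun x => f x ^+ k).
Proof.
move=> cf; elim: k => [|k IH].
  rewrite (_ : (fun _ => _) = cst 1); first exact: cst_continuous.
  by apply/funext => x; rewrite expr0.
rewrite (_ : (fun _ => _) = fun x => f x * f x ^+ k); first exact: continuous_funM.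
by apply/funext => x; rewrite exprS.
Qed.

Lemma continuous_funcomp (g : R -> R) f :
  continuous g -> continuous f -> continuous (fun x => g (f x)).
Proof. by move=> cg cf x; apply: continuous_comp; [exact: cf|exact: cg]. Qed.

Lemma continuous_fun_sum (I : Type) (s : seq I) (P : pred I) (f : I -> T -> R) :
  (forall i, P i -> continuous (f i)) ->
  continuous (fun x => \sum_(i <- s | P i) f i x).
Proof.
move=> cf; elim: s => [|i s IH].
  rewrite (_ : (fun _ => _) = cst 0); first exact: cst_continuous.
  by apply/funext => x; rewrite big_nil.
have [Pi|nPi] := boolP (P i); last first.
  rewrite (_ : (fun _ => _) = fun x => \sum_(j <- s | P j) f j x)//.
  by apply/funext => x; rewrite big_cons (negPf nPi).
rewrite (_ : (fun _ => _) = fun x => f i x + \sum_(j <- s | P j) f j x).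
  by apply: continuous_funD => //; exact: cf.
by apply/funext => x; rewrite big_cons Pi.
Qed.

End ContinuousFunctions.

(** Matching on the syntax of the function keeps unification from unfolding
derivatives and matrix operations in search of a sum or a product. *)
Ltac solve_continuous :=
  match goal with
  | H : ?P |- ?P => exact H
  | _ => lazymatch goal with
    | |- forall x, continuous_at x (fun y => @?f y + - @?g y) =>
        apply: (@continuous_funB _ _ f g); solve_continuous
    | |- forall x, continuous_at x (fun y => @?f y + @?g y) =>
        apply: (@continuous_funD _ _ f g); solve_continuous
    | |- forall x, continuous_at x (fun y => @?f y * @?g y) =>
        apply: (@continuous_funM _ _ f g); solve_continuous
    | |- forall x, continuous_at x (fun y => @?f y ^+ ?k) =>
        apply: (@continuous_funX _ _ f k); solve_continuous
    | |- forall x, continuous_at x (fun y => - @?f y) =>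
        apply: (@continuous_funN _ _ f); solve_continuous
    | |- forall x, continuous_at x (fun y => ?c) =>
        try exact: cst_continuous
    | |- _ => try assumption
    end
  end.

Section Ultralimit.
Context {R : realType}.

Definition some_ultrafilter : set_system nat :=
  sval (cid (ultraFilterLemma (@eventually_filter))).

#[local] Instance some_ultrafilter_ultra : UltraFilter some_ultrafilter.
Proof. by rewrite /some_ultrafilter; case: cid => U []. Qed.

Lemma eventually_some_ultrafilter : \oo `<=` some_ultrafilter.
Proof. by rewrite /some_ultrafilter; case: cid => U []. Qed.

(** Convergence along an ultrafilter finer than the eventual filter: every
bounded sequence has such a limit, and it is linear and monotone. *)
Definition ulim (u : nat -> R) : R := lim (u @ some_ultrafilter).

Definition bounded_seq (u : nat -> R) := exists M, forall n, `|u n| <= M.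

(** The image of an ultrafilter is an ultrafilter, and an ultrafilter that
contains a compact interval converges. *)
Lemma ulim_cvg u : bounded_seq u -> u @ some_ultrafilter --> ulim u.
Proof.
move=> [M uM]; apply/cvg_ex.
have UF : UltraFilter (u @ some_ultrafilter).
  split; first exact: fmap_proper_filter.
  move=> G GF sG; rewrite predeqE => A; split; last exact: sG.
  move=> GA; have [//|nA] := pselect ((u @ some_ultrafilter) A).
  (* H adjoins the preimage of A to the ultrafilter; it is proper because a
     disjoint member would put both A and its complement in G. *)
  pose H := filter_from some_ultrafilter (fun B => B `&` u @^-1` A).
  have HF : ProperFilter H.
    apply: filter_from_proper; last first.
      move=> B UB; apply: contrapT => /set0P/negP; rewrite negbK => /eqP B0.
      have : G (~` A).
        apply: sG; apply: filterS UB => n Bn An.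
        by have : (B `&` u @^-1` A) n by []; rewrite B0.
      by move=> /(filterI GA); rewrite setICr => /filter_ex[x []].
    apply: filter_from_filter; first by exists setT; exact: filterT.
    move=> B C UB UC; exists (B `&` C); first exact: filterI.
    by move=> n [[Bn Cn] An].
  have HU : H = some_ultrafilter.
    apply: max_filter => B UB; exists B => //; by move=> n [].
  apply: (_ : some_ultrafilter (u @^-1` A)).
  by rewrite -HU; exists setT; [exact: filterT|move=> n []].
have := @segment_compact R (- M) M.
rewrite compact_ultra => /(_ _ UF)[|l [_ ul]]; last by exists l.
by apply: (@filterE _ some_ultrafilter) => n /=; rewrite in_itv/= -ler_norml.
Qed.

Lemma ulim_eq u l : u @ some_ultrafilter --> l -> ulim u = l.
Proof. exact: cvg_lim. Qed.

Lemma ulim_cvgoo u l : u @ \oo --> l -> ulim u = l.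
Proof.
move=> ul; apply: ulim_eq; apply: cvg_trans ul.
exact: (cvg_app u eventually_some_ultrafilter).
Qed.

Lemma ulimD u v : bounded_seq u -> bounded_seq v ->
  ulim (fun n => u n + v n) = ulim u + ulim v.
Proof. by move=> bu bv; apply: ulim_eq; apply: cvgD; exact: ulim_cvg. Qed.

Lemma ulimZ k u : bounded_seq u -> ulim (fun n => k * u n) = k * ulim u.
Proof. by move=> bu; apply: ulim_eq; apply: cvgMr; exact: ulim_cvg. Qed.

Lemma le_ulim u v : bounded_seq u -> bounded_seq v ->
  (\forall n \near \oo, u n <= v n) -> ulim u <= ulim v.
Proof.
move=> bu bv uv; apply: ler_cvg_to (ulim_cvg bu) (ulim_cvg bv) _.
exact: eventually_some_ultrafilter.
Qed.

End Ultralimit.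

(** * A positive linear mean over a box *)

Section RowVectors.
Context {R : realType}.

Lemma continuous_row (T : topologicalType) (d : nat) (F : T -> 'rV[R]_d) :
  (forall j, continuous (fun x => F x 0 j)) -> continuous F.
Proof.
move=> cF x A [B FB sBA]; apply: filterS (_ : \forall y \near x, forall i j, B i j (F
  y i j)).
  by move=> y By; apply: sBA.
apply: filter_forall => i; apply: filter_forall => j.
by have := FB i j; rewrite !ord1 => /(cF j x).
Qed.

Definition set_coord d (z : 'rV[R]_d) (i : 'I_d) (t : R) : 'rV[R]_d :=
  \row_j (if j == i then t else z 0 j).

Lemma set_coord_shift d (z : 'rV[R]_d) i (s t : R) :
  set_coord z i (s + t) = s *: delta_mx 0 i + set_coord z i t.
Proof.
apply/rowP => j; rewrite !mxE eqxx/=; case: eqP => _; last by rewrite mulr0 add0r.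
by rewrite mulr1.
Qed.

Lemma set_coord_id d (z : 'rV[R]_d) i : set_coord z i (z 0 i) = z.
Proof. by apply/rowP => j; rewrite mxE; case: eqP => [->|]. Qed.

Lemma continuous_set_coord d (z : 'rV[R]_d) i : continuous (set_coord z i).
Proof.
apply: continuous_row => j.
rewrite (_ : (fun _ => _) = if j == i then id else cst (z 0 j)); last first.
  by apply/funext => t; rewrite mxE; case: eqP.
by case: eqP => _ x; [exact: cvg_id|exact: cvg_cst].
Qed.

(** The tube lemma: it provides the uniform estimates used both in the
fundamental theorem and in differentiation under the mean. *)
Lemma near_uniform_compact (X T : topologicalType) (K : set T)
    (H : X -> T -> R) (x0 : X) :
  compact K -> (forall t, K t -> {for (x0, t), continuous (fun p => H p.1 p.2)}) ->
  forall e, 0 < e ->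
  \forall x \near x0, forall t, K t -> `|H x t - H x0 t| < e.
Proof.
move=> /compact_near_coveringP cK cH e e0.
have e2 : 0 < e / 2 by rewrite divr_gt0.
apply: (cK _ (nbhs x0) (fun x t => `|H x t - H x0 t| < e)) => t Kt.
have /cvgr_dist_lt/(_ _ e2)[[/= A B] [Ax Bt] AB] := cH t Kt.
exists (B, A) => //= -[t' x]/= [Bt' Ax'].
have h1 := AB (x, t') (conj Ax' Bt').
have h2 := AB (x0, t') (conj (nbhs_singleton Ax) Bt').
rewrite /= distrC in h1; rewrite /= in h2.
rewrite [e]splitr -(subrK (H x0 t) (H x t')) -addrA.
by apply: le_lt_trans (ler_normD _ _) _; exact: ltrD.
Qed.

End RowVectors.

Section BoxMean.
Context {R : realType} {d : nat}.
Variables (l r : 'rV[R]_d).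
Hypothesis lr : forall i, l 0 i < r 0 i.

Implicit Types F G : 'rV[R]_d -> R.

Definition box : set 'rV[R]_d := [set z | forall i, l 0 i <= z 0 i <= r 0 i].

(** The sample points of the Riemann sums avoid the lower faces, so integrands
need to be compared only here; for the kernel below this keeps y > 0. *)
Definition half_open_box : set 'rV[R]_d :=
  [set z | forall i, l 0 i < z 0 i <= r 0 i].

Lemma sub_half_open_box : half_open_box `<=` box.
Proof. by move=> z hz i; have /andP[/ltW -> ->] := hz i. Qed.

Lemma compact_box : compact box.
Proof.
have -> : box = [set z : 'rV[R]_d | forall i, `[l 0 i, r 0 i]%classic (z ord0 i)].
  by apply/seteqP; split => z hz i; have := hz i; rewrite /= in_itv.
by apply: (@rV_compact _ _ (fun i => `[l 0 i, r 0 i]%classic)) => i;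
  exact: segment_compact.
Qed.

Definition tick (N : nat) (i : 'I_d) (k : nat) : R :=
  l 0 i + (r 0 i - l 0 i) * (k%:R / N.+1%:R).

Definition grid_point N (q : {ffun 'I_d -> 'I_N.+1}) : 'rV[R]_d :=
  \row_i tick N i (q i).+1.

Definition riemann_sum (F : 'rV[R]_d -> R) (N : nat) : R :=
  (N.+1 ^ d)%:R^-1 * \sum_(q : {ffun 'I_d -> 'I_N.+1}) F (grid_point q).

Definition mean (F : 'rV[R]_d -> R) : R := ulim (riemann_sum F).

Lemma tick0 N i : tick N i 0 = l 0 i.
Proof. by rewrite /tick mul0r mulr0 addr0. Qed.

Lemma tick_last N i : tick N i N.+1 = r 0 i.
Proof. by rewrite /tick divff// mulr1 addrC subrK. Qed.

Lemma tickS N i k : tick N i k.+1 = tick N i k + (r 0 i - l 0 i) / N.+1%:R.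
Proof. by rewrite /tick -[k.+1%:R]natr1 (mulrDl k%:R) div1r mulrDr addrA. Qed.

Lemma lt_tick N i j k : (j < k)%N -> tick N i j < tick N i k.
Proof.
move=> jk; rewrite /tick ltrD2l ltr_pM2l ?subr_gt0//.
by rewrite ltr_pM2r ?invr_gt0 ?ltr0n// ltr_nat.
Qed.

Lemma le_tick N i j k : (j <= k)%N -> tick N i j <= tick N i k.
Proof. by rewrite leq_eqVlt => /predU1P[->//|/(lt_tick N i)/ltW]. Qed.

Lemma half_open_box_grid N q : half_open_box (@grid_point N q).
Proof.
move=> i; rewrite mxE -{1}(tick0 N) -(tick_last N) lt_tick//.
by rewrite le_tick// ltn_ord.
Qed.

Lemma riemann_sum_le F G N : (forall z, half_open_box z -> F z <= G z) ->
  riemann_sum F N <= riemann_sum G N.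
Proof.
move=> FG; rewrite /riemann_sum ler_wpM2l ?invr_ge0//.
by apply: ler_sum => q _; apply: FG; exact: half_open_box_grid.
Qed.

Lemma riemann_sum_cst (c : R) N : riemann_sum (fun=> c) N = c.
Proof.
by rewrite /riemann_sum sumr_const card_ffun !card_ord -(mulr_natl c) mulKf.
Qed.

Lemma continuous_bounded_box F : continuous F ->
  exists M : R, forall z, box z -> `|F z| <= M.
Proof.
move=> cF; have : compact (F @` box).
  by apply: continuous_compact compact_box; exact: continuous_subspaceT.
move=> /compact_bounded/ex_strict_bound_gt0[M _ FM].
by exists M => z bz; apply/ltW/FM; exists z.
Qed.

Lemma bounded_riemann_sum F : continuous F -> bounded_seq (riemann_sum F).
Proof.
move=> /continuous_bounded_box[M FM]; exists M => N; rewrite ler_norml.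
have FM' z : half_open_box z -> - M <= F z <= M.
  by move=> /sub_half_open_box/FM; rewrite ler_norml.
rewrite -{1}(riemann_sum_cst (- M) N) -{2}(riemann_sum_cst M N).
by rewrite !riemann_sum_le// => z /FM' /andP[].
Qed.

Lemma meanD F G : continuous F -> continuous G ->
  mean (fun z => F z + G z) = mean F + mean G.
Proof.
move=> cF cG; rewrite /mean -ulimD; [|exact: bounded_riemann_sum..].
by congr ulim; apply/funext => N; rewrite /riemann_sum big_split mulrDr.
Qed.

Lemma meanZ k F : continuous F -> mean (fun z => k * F z) = k * mean F.
Proof.
move=> cF; rewrite /mean -ulimZ; [|exact: bounded_riemann_sum..].
by congr ulim; apply/funext => N; rewrite /riemann_sum -mulr_sumr mulrCA.
Qed.

Lemma meanB F G : continuous F -> continuous G ->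
  mean (fun z => F z - G z) = mean F - mean G.
Proof.
move=> cF cG; rewrite meanD//; last by move=> z; exact: (continuousN (cG z)).
congr (_ + _); rewrite -mulN1r -meanZ//.
by congr mean; apply/funext => z; rewrite mulN1r.
Qed.

Lemma mean_cst c : mean (fun=> c) = c.
Proof.
rewrite /mean (_ : riemann_sum _ = cst c); last first.
  by apply/funext => N; exact: riemann_sum_cst.
by apply: ulim_cvgoo; exact: cvg_cst.
Qed.

Lemma mean_sum (I : Type) (s : seq I) (F : I -> 'rV[R]_d -> R) :
  (forall i, continuous (F i)) ->
  mean (fun z => \sum_(i <- s) F i z) = \sum_(i <- s) mean (F i).
Proof.
move=> cF; elim: s => [|i s IH].
  rewrite big_nil (_ : (fun _ => _) = cst 0) ?mean_cst//.
  by apply/funext => z; rewrite big_nil.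
rewrite big_cons -IH -meanD//; last exact: continuous_fun_sum.
by congr mean; apply/funext => z; rewrite big_cons.
Qed.

Lemma le_mean F G : continuous F -> continuous G ->
  (forall z, half_open_box z -> F z <= G z) -> mean F <= mean G.
Proof.
move=> cF cG FG; apply: le_ulim; [exact: bounded_riemann_sum..|].
by apply: nearW => N; exact: riemann_sum_le.
Qed.

Lemma eq_mean F G :
  (forall z, half_open_box z -> F z = G z) -> mean F = mean G.
Proof.
move=> FG; congr ulim; apply/funext => N; congr (_ * _).
by apply: eq_bigr => q _; rewrite FG//; exact: half_open_box_grid.
Qed.

Lemma norm_mean_le F c : continuous F ->
  (forall z, half_open_box z -> `|F z| <= c) -> `|mean F| <= c.
Proof.
move=> cF Fc; rewrite ler_norml -{1}(mean_cst (- c)) -{2}(mean_cst c).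
by apply/andP; split; apply: le_mean => //; do ?exact: cst_continuous;
  by move=> z /Fc; rewrite ler_norml => /andP[].
Qed.

(** Swapping the new index with the overwritten one is an involution of the
pairs (q, k), so overwriting an index merely repeats every term. *)
Lemma sum_set_index N (i : 'I_d) (H : {ffun 'I_d -> 'I_N.+1} -> R) :
  \sum_(q : {ffun 'I_d -> 'I_N.+1}) \sum_(k < N.+1)
    H [ffun j => if j == i then k else q j] =
  N.+1%:R * \sum_q H q.
Proof.
pose phi (p : {ffun 'I_d -> 'I_N.+1} * 'I_N.+1) :=
  ([ffun j => if j == i then p.2 else p.1 j], p.1 i).
have phiK : involutive phi.
  move=> [q k]; rewrite /phi/=; congr (_, _); last by rewrite ffunE eqxx.
  by apply/ffunP => j; rewrite !ffunE; case: eqP => [->|].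
rewrite pair_big/= (reindex_inj (inv_inj phiK))/=.
transitivity (\sum_(p : {ffun 'I_d -> 'I_N.+1} * 'I_N.+1) H p.1).
  by apply: eq_bigr => p _; rewrite -[in RHS](phiK p).
rewrite -(pair_big xpredT xpredT (fun q (k : 'I_N.+1) => H q))/= mulr_sumr.
by apply: eq_bigr => q _; rewrite sumr_const card_ord mulr_natl.
Qed.

Lemma grid_point_set_index N (i : 'I_d) (q : {ffun 'I_d -> 'I_N.+1}) k :
  grid_point [ffun j => if j == i then k else q j] =
  set_coord (grid_point q) i (tick N i k.+1).
Proof. by apply/rowP => j; rewrite !mxE ffunE; case: eqP => [->|]. Qed.

(** The fundamental theorem of calculus in the coordinate [i]: on each grid line
the Riemann sum of the derivative telescopes up to the oscillation of [g] over
one cell, which is uniformly small. *)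
Lemma mean_partial i (G g : 'rV[R]_d -> R) K :
  continuous g -> continuous G ->
  (forall z, half_open_box z -> forall t, l 0 i < t < r 0 i ->
     is_derive t 1 (fun s => G (set_coord z i s)) (g (set_coord z i t))) ->
  (forall z, half_open_box z ->
     G (set_coord z i (r 0 i)) - G (set_coord z i (l 0 i)) = K) ->
  mean g = K / (r 0 i - l 0 i).
Proof.
move=> cg cG dG GK; set w := r 0 i - l 0 i.
have w0 : 0 < w by rewrite subr_gt0.
apply: ulim_cvgoo; apply/cvgrPdist_le => e e0.
pose H (s : R) (z : 'rV[R]_d) := g (s *: delta_mx 0 i + z).
have cH z : box z -> {for (0, z), continuous (fun p => H p.1 p.2)}.
  move=> _; apply: (@continuous_comp _ _ _
    (fun p : R * 'rV[R]_d => p.1 *: delta_mx 0 i + p.2) g); last exact: cg.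
  by apply: cvgD; [apply: cvgZr_tmp; exact: cvg_fst|exact: cvg_snd].
have /nbhs_ballP[del /= del0 Hdel] := near_uniform_compact compact_box cH e0.
near=> N.
have wN : w / N.+1%:R < del.
  rewrite mulrC -ltr_pdivlMr//; near: N.
  exact: (near_infty_natSinv_lt (PosNum (divr_gt0 del0 w0))).
have N0 : (N.+1%:R : R) != 0 by rewrite pnatr_eq0.
have key (q : {ffun 'I_d -> 'I_N.+1}) : `|K / w - N.+1%:R^-1 *
    \sum_(k < N.+1) g (grid_point [ffun j => if j == i then k else q j])| <= e.
  set z := grid_point q.
  have bz : half_open_box z by exact: half_open_box_grid.
  have -> : K = \sum_(k < N.+1) (G (set_coord z i (tick N i k.+1)) -
      G (set_coord z i (tick N i k))).
    rewrite -(GK _ bz) -(tick_last N) -{1}(tick0 N).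
    rewrite -(big_mkord xpredT (fun k => G (set_coord z i (tick N i k.+1)) -
      G (set_coord z i (tick N i k)))).
    by rewrite (telescope_sumr (fun k => G (set_coord z i (tick N i k)))).
  rewrite mulr_suml mulr_sumr -sumrB.
  apply: le_trans (ler_norm_sum _ _ _) _.
  have -> : e = \sum_(k < N.+1) (N.+1%:R^-1 * e).
    by rewrite sumr_const card_ord -(mulr_natl (_ * e)) mulVKf.
  apply: ler_sum => k _; rewrite grid_point_set_index -/z.
  have tk : tick N i k < tick N i k.+1 by exact: lt_tick.
  have l_tk : l 0 i <= tick N i k by rewrite -(tick0 N) le_tick.
  have tk_r : tick N i k.+1 <= r 0 i by rewrite -(tick_last N) le_tick.
  have [||x xk ->] := @MVT R (fun s => G (set_coord z i s))
      (fun s => g (set_coord z i s)) _ _ tk.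
  - move=> x; rewrite in_itv/= => /andP[kx xk]; apply: dG => //.
    by rewrite (le_lt_trans l_tk kx) (lt_le_trans xk tk_r).
  - apply: continuous_subspaceT => s.
    by apply: continuous_comp; [exact: continuous_set_coord|exact: cG].
  have -> : tick N i k.+1 - tick N i k = w / N.+1%:R by rewrite tickS addrC addKr.
  have -> : g (set_coord z i x) * (w / N.+1%:R) / w -
      N.+1%:R^-1 * g (set_coord z i (tick N i k.+1)) =
      N.+1%:R^-1 * (g (set_coord z i x) - g (set_coord z i (tick N i k.+1))).
    by move: N0 (gt_eqF w0); set m := N.+1%:R => m0 /negbT wn0; field; apply/andP.
  rewrite normrM ger0_norm ?invr_ge0// ler_wpM2l ?invr_ge0//.
  have xt : ball 0 del (x - tick N i k.+1).
    move: xk; rewrite in_itv/= => /andP[kx xk].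
    rewrite -ball_normE/= sub0r normrN ltr_norml; apply/andP; split.
      by rewrite tickS -/w ltrNl opprB (lt_trans _ wN)// ltrBlDr addrC ltrD2l.
    by rewrite (lt_trans _ del0)// subr_lt0.
  have bk : box (set_coord z i (tick N i k.+1)).
    rewrite /z -grid_point_set_index; apply: sub_half_open_box.
    exact: half_open_box_grid.
  have := Hdel _ xt _ bk.
  by rewrite /H scale0r add0r -set_coord_shift subrK => /ltW.
have D0 : ((N.+1 ^ d)%:R : R) != 0 by rewrite pnatr_eq0 expn_eq0.
have -> : K / w - riemann_sum g N = (N.+1 ^ d)%:R^-1 *
   \sum_(q : {ffun 'I_d -> 'I_N.+1}) (K / w - N.+1%:R^-1 *
    \sum_(k < N.+1) g (grid_point [ffun j => if j == i then k else q j])).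
  have := sum_set_index i (fun q : {ffun 'I_d -> 'I_N.+1} => g (grid_point q)).
  move=> /= sumE; rewrite sumrB -[X in _ * (_ - X)]mulr_sumr sumE mulKf//.
  by rewrite sumr_const card_ffun !card_ord mulrBr -(mulr_natl (K / w)) mulKf.
rewrite normrM ger0_norm ?invr_ge0//.
have -> : e = (N.+1 ^ d)%:R^-1 * \sum_(q : {ffun 'I_d -> 'I_N.+1}) e.
  by rewrite sumr_const card_ffun !card_ord -(mulr_natl e) mulKf.
rewrite ler_wpM2l ?invr_ge0//.
by apply: le_trans (ler_norm_sum _ _ _) _; apply: ler_sum => q _; exact: key.
Unshelve. all: end_near.
Qed.

(** A lower bound on the share of grid points in [[a, b]], obtained by
telescoping the clamp of the identity to [[a, b - h]], with h the mesh: each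
increment is at most h and vanishes unless the right end point of the cell lies
in [[a, b]]. *)
Lemma tick_frequency i (a b : R) : l 0 i <= a -> a < b -> b <= r 0 i ->
  \forall N \near \oo, (b - a) / 2 / (r 0 i - l 0 i) <=
    N.+1%:R^-1 * \sum_(k < N.+1) (a <= tick N i k.+1 <= b)%R%:R.
Proof.
move=> la ab br; set w := r 0 i - l 0 i.
have w0 : 0 < w by rewrite subr_gt0.
have ba0 : 0 < (b - a) / 2 by rewrite divr_gt0// subr_gt0.
near=> N.
have hN : w / N.+1%:R < (b - a) / 2.
  rewrite mulrC -ltr_pdivlMr//; near: N.
  exact: (near_infty_natSinv_lt (PosNum (divr_gt0 ba0 w0))).
set h := w / N.+1%:R in hN; have h0 : 0 < h by rewrite divr_gt0.
pose phi t := Num.max a (Num.min t (b - h)).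
have abh : a <= b - h by move: hN; lra.
have phil : phi (l 0 i) = a.
  by rewrite /phi min_l ?(le_trans la)// max_l.
have phir : phi (r 0 i) = b - h.
  by rewrite /phi min_r ?max_r//; move: hN h0 br; lra.
have step (k : 'I_N.+1) : phi (tick N i k.+1) - phi (tick N i k) <=
    h * (a <= tick N i k.+1 <= b)%R%:R.
  rewrite tickS -/w -/h; set t := tick N i k; rewrite /phi.
  have [at_|ta] := leP a (t + h); last first.
    have ta' : t <= a by rewrite (le_trans _ (ltW ta))// lerDl ltW.
    by rewrite /= mulr0 !max_l ?subrr// ge_min ?(ltW ta) ?ta'.
  have [tb|bt] := leP (t + h) b; rewrite /= ?mulr1 ?mulr0; last first.
    have cbt : b - h <= t by rewrite lerBlDr ltW.
    by rewrite !min_r ?subrr// (le_trans cbt)// lerDl ltW.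
  rewrite lerBlDl ge_max; apply/andP; split.
    by rewrite -[leLHS]addr0 lerD ?le_max ?lexx// ltW.
  rewrite -lerBlDr le_max; apply/orP; right.
  by rewrite le_min; apply/andP; split; rewrite lerBlDr ge_min ?lexx// lerDl (ltW h0)
    orbT.
rewrite ler_pdivrMr// [leRHS]mulrC mulrA -/h mulr_sumr.
apply: (@le_trans _ _ (phi (r 0 i) - phi (l 0 i))); first by rewrite phil phir;
  move: hN; lra.
rewrite -(tick_last N) -(tick0 N).
rewrite -(@telescope_sumr _ 0 N.+1 (fun k => phi (tick N i k)))// big_mkord.
by apply: ler_sum => k _; exact: step.
Unshelve. all: end_near.
Qed.

(** Near [z0] the function exceeds half of its value, on a product of intervals
whose share of grid points is bounded below in each coordinate. *)
Lemma mean_gt0 F (z0 : 'rV[R]_d) : continuous F ->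
  (forall z, half_open_box z -> 0 <= F z) ->
  (forall i, l 0 i < z0 0 i < r 0 i) -> 0 < F z0 -> 0 < mean F.
Proof.
move=> cF F0 z0lr Fz0.
have Fz2 : 0 < F z0 / 2 by rewrite divr_gt0.
have /nbhs_ballP[e /= e0 Fe] : \forall z \near z0, F z0 / 2 < F z.
  by apply: (cvgr_gt (F z0) (cF z0)); rewrite ltr_pdivrMr// ltr_pMr// ltr1n.
(* Below each coordinate of z0, an interval within the box and within e / 2. *)
pose a i := Num.max (l 0 i) (z0 0 i - e / 2).
have az i : a i < z0 0 i.
  by rewrite gt_max; have /andP[-> _] := z0lr i; rewrite ltrBlDr ltrDl divr_gt0.
have la i : l 0 i <= a i by rewrite le_max lexx.
have zr i : z0 0 i <= r 0 i by have /andP[_ /ltW] := z0lr i.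
pose chi N i (k : 'I_N.+1) : R := (a i <= tick N i k.+1 <= z0 0 i)%R%:R.
pose m i := (z0 0 i - a i) / 2 / (r 0 i - l 0 i).
have m0 i : 0 < m i by rewrite !divr_gt0// subr_gt0.
have near_m : \forall N \near \oo, forall i,
    m i <= N.+1%:R^-1 * \sum_(k < N.+1) chi N i k.
  by apply: filter_forall => i; exact: tick_frequency.
have lower N (q : {ffun 'I_d -> 'I_N.+1}) :
    F z0 / 2 * \prod_i chi N i (q i) <= F (grid_point q).
  have [/forallP H|/forallPn[i /negPf H]] :=
      boolP [forall i, a i <= tick N i (q i).+1 <= z0 0 i]; last first.
    rewrite (bigD1 i)//= /chi H mul0r mulr0 F0//; exact: half_open_box_grid.
  rewrite big1 ?mulr1; last by move=> i _; rewrite /chi H.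
  apply/ltW/Fe; split => // i j; rewrite ord1 mxE /ball/=.
  have /andP[/= + tz] := H j; rewrite /a ge_max => /andP[_ zt].
  by rewrite ger0_norm ?subr_ge0// ltrBlDl -ltrBlDr; move: zt e0; lra.
apply: (@lt_le_trans _ _ (F z0 / 2 * \prod_i m i)).
  by rewrite mulr_gt0// prodr_gt0.
rewrite -(mean_cst (F z0 / 2 * \prod_i m i)); apply: le_ulim.
- by apply: bounded_riemann_sum; exact: cst_continuous.
- exact: bounded_riemann_sum.
apply: filterS near_m => N mN; rewrite riemann_sum_cst.
apply: (@le_trans _ _ (F z0 / 2 *
    \prod_i (N.+1%:R^-1 * \sum_(k < N.+1) chi N i k))).
  by rewrite ler_wpM2l ?(ltW Fz2)//; apply: ler_prod => i _; rewrite ltW//=.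
rewrite big_split/= prodr_const card_ord exprVn -natrX.
rewrite mulrCA /riemann_sum ler_wpM2l ?invr_ge0//.
rewrite bigA_distr_bigA/= mulr_sumr; apply: ler_sum => q _; exact: lower.
Qed.

End BoxMean.

(** * Derivatives along coordinate lines and under the mean *)

Section Lines.
Context {R : realType} {n : nat}.
Implicit Types (f : 'rV[R]_n.+1 -> R) (x z : 'rV[R]_n.+1).

(** The difference quotients of a partial derivative are those of the
restriction to a coordinate line, so one-variable calculus applies. *)
Lemma set_coord_quotient f z i (t : R) :
  (fun h : R => h^-1 *: (((fun s => f (set_coord z i s)) \o shift t) (h *: (1 : R)) -
     f (set_coord z i t))) =
  (fun h => h^-1 *: ((f \o shift (set_coord z i t)) (h *: basis_vec R i) -
     f (set_coord z i t))).
Proof.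
apply/funext => h /=; rewrite -set_coord_shift.
by congr (_ *: (f (set_coord _ _ (_ + _)) - _)); exact: mulr1.
Qed.

Lemma is_derive_set_coord f z i (t l : R) :
  is_derive (set_coord z i t) (basis_vec R i) f l <->
  is_derive t 1 (fun s => f (set_coord z i s)) l.
Proof.
by split => -[df fl]; split;
  [rewrite /derivable set_coord_quotient|rewrite -fl /derive set_coord_quotient
  |rewrite /derivable -set_coord_quotient|rewrite -fl /derive -set_coord_quotient].
Qed.

Lemma is_derive_partial f z i (t : R) :
  (forall x, derivable f x (basis_vec R i)) ->
  is_derive t 1 (fun s => f (set_coord z i s)) (partial i f (set_coord z i t)).
Proof. by move=> df; apply/is_derive_set_coord; split => //; exact: df. Qed.

Lemma partial_of_line f x i (l : R) :
  is_derive (x 0 i) 1 (fun s => f (set_coord x i s)) l ->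
  derivable f x (basis_vec R i) /\ partial i f x = l.
Proof. by move=> /is_derive_set_coord; rewrite set_coord_id => -[]. Qed.

End Lines.

Section MeanWithParameter.
Context {R : realType}.

Lemma mean_value (f df : R -> R) (a b : R) :
  (forall s : R, is_derive s 1 f (df s)) ->
  exists2 c, `|c - a| <= `|b - a| & f b - f a = df c * (b - a).
Proof.
move=> dfE.
have cf : continuous f.
  by move=> s; apply/differentiable_continuous/derivable1_diffP; case: (dfE s).
have [ab|ba] := leP a b.
  have [|c] := MVT_segment ab (fun s _ => dfE s).
    exact: continuous_subspaceT.
  rewrite in_itv/= => /andP[ac cb] ->; exists c => //.
  by rewrite !ger0_norm ?subr_ge0// lerD2r.
have [|c] := MVT_segment (ltW ba) (fun s _ => dfE s).
  exact: continuous_subspaceT.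
rewrite in_itv/= => /andP[bc ca] E; exists c; last first.
  by rewrite -(opprB (f a)) E -mulrN opprB.
by rewrite ![`|_ - a|]distrC !ger0_norm ?subr_ge0// ?lerD2l ?lerN2// ltW.
Qed.

Context {d : nat}.
Variables (l r : 'rV[R]_d).
Hypothesis lr : forall i, l 0 i < r 0 i.

Lemma continuous_section (X T U : topologicalType) (H : X -> T -> U) x :
  continuous (fun p => H p.1 p.2) -> continuous (H x).
Proof.
move=> cH t; apply: (@continuous_comp _ _ _ (pair x) (fun p => H p.1 p.2)).
  by apply: cvg_pair; [exact: cvg_cst|exact: cvg_id].
exact: cH.
Qed.

Lemma continuous_mean (X : topologicalType) (H : X -> 'rV[R]_d -> R) :
  continuous (fun p => H p.1 p.2) -> continuous (fun x => mean l r (H x)).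
Proof.
move=> cH x; apply/cvgrPdist_le => e e0.
have := near_uniform_compact (@compact_box R d l r) (fun t _ => cH (x, t)) e0.
apply: filterS => y Hy; rewrite -(meanB lr); [|exact: continuous_section..].
apply: (norm_mean_le lr).
  by apply: continuous_funB; exact: continuous_section.
by move=> z /sub_half_open_box/Hy/ltW; rewrite distrC.
Qed.

Lemma is_derive_mean (H H' : R -> 'rV[R]_d -> R) (s : R) :
  continuous (fun p => H p.1 p.2) -> continuous (fun p => H' p.1 p.2) ->
  (forall z (s : R), is_derive s 1 (H ^~ z) (H' s z)) ->
  is_derive s 1 (fun s => mean l r (H s)) (mean l r (H' s)).
Proof.
move=> cH cH' dH.
suff qH : (fun h : R => h^-1 *: (((fun s => mean l r (H s)) \o shift s) (h *: (1 :
  R)) -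
     mean l r (H s))) @ 0^' --> mean l r (H' s).
  by split; [apply/cvg_ex; exists (mean l r (H' s))|exact: cvg_lim].
apply/cvgrPdist_le => e e0.
have /nbhs_ballP[del /= del0 Hdel] :=
  near_uniform_compact (@compact_box R d l r) (fun t _ => cH' (s, t)) e0.
near=> h.
have h0 : h != 0 by near: h; exact: nbhs_dnbhs_neq.
have hdel : `|h| < del.
  near: h; apply: cvg_within; apply/nbhs_ballP; exists del => //= h.
  by rewrite -ball_normE/= sub0r normrN.
rewrite /=; set s' := h *: 1 + s.
have s'E : s' - s = h by rewrite addrK; exact: mulr1.
have cHs t : continuous (H t) by exact: continuous_section.
have cHs' t : continuous (H' t) by exact: continuous_section.
have cD : continuous (fun z => H s' z - H s z) by exact: continuous_funB.
have cQ : continuous (fun z => h^-1 * (H s' z - H s z)).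
  by apply: continuous_funM => //; exact: cst_continuous.
have -> : mean l r (H' s) - h^-1 *: (mean l r (H s') - mean l r (H s)) =
    mean l r (fun z => H' s z - h^-1 * (H s' z - H s z)).
  by rewrite (meanB lr)// (meanZ lr)// (meanB lr).
apply: (norm_mean_le lr); first exact: continuous_funB.
move=> z /sub_half_open_box bz.
have [c cs ->] := mean_value s s' (dH z).
rewrite s'E (mulrC _ h) mulKf// ltW// distrC.
by apply: (Hdel c) => //; rewrite -ball_normE/= distrC (le_lt_trans cs)// s'E.
Unshelve. all: end_near.
Qed.

End MeanWithParameter.

(** * The weighted Laplacian preserves regularity and evenness *)

Section LastCoordinateAverage.
Context {R : realType} {n : nat}.
Implicit Types (f h : 'rV[R]_n.+1 -> R) (x : 'rV[R]_n.+1).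

Definition scale_last (t : R) x : 'rV[R]_n.+1 :=
  set_coord x ord_max (t * x 0 ord_max).

Definition segment_mean : ('rV[R]_1 -> R) -> R := mean 0 (const_mx 1).

(** The weight t^j keeps this class of averages closed under differentiation:
each derivative in the last variable brings out one factor t. *)
Definition last_average (j : nat) h x : R :=
  segment_mean (fun z => z 0 0 ^+ j * h (scale_last (z 0 0) x)).

Lemma lt_segment_ends (i : 'I_1) : (0 : 'rV[R]_1) 0 i < (const_mx 1 : 'rV[R]_1) 0 i.
Proof. by rewrite !mxE. Qed.

Lemma continuous_scale_last (T : topologicalType) (t : T -> R) (x : T -> 'rV[R]_n.+1)
  :
  continuous t -> continuous x -> continuous (fun p => scale_last (t p) (x p)).
Proof.
move=> ct cx; apply: continuous_row => j.
have cxj k : continuous (fun p => x p 0 k).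
  move=> p; apply: (@continuous_comp _ _ _ x (fun y : 'rV[R]_n.+1 => y 0 k)).
    exact: cx.
  exact: coord_continuous.
rewrite (_ : (fun _ => _) = if j == ord_max then (fun p => t p * x p 0 ord_max)
   else (fun p => x p 0 j)); last by apply/funext => p; rewrite mxE; case: eqP.
by case: eqP => _ //; exact: continuous_funM.
Qed.

Lemma continuous_average_integrand (T : topologicalType) j h (y : T -> 'rV[R]_n.+1) :
  continuous h -> continuous y ->
  continuous (fun p : T * 'rV[R]_1 => p.2 0 0 ^+ j * h (scale_last (p.2 0 0) (y
    p.1))).
Proof.
move=> ch cy.
have c2 : continuous (fun p : T * 'rV[R]_1 => p.2 0 0).
  move=> p; apply: (@continuous_comp _ _ _ snd (fun z : 'rV[R]_1 => z 0 0)).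
    exact: cvg_snd.
  exact: coord_continuous.
apply: continuous_funM; first exact: continuous_funX.
move=> p; apply: (@continuous_comp _ _ _
  (fun p : T * 'rV[R]_1 => scale_last (p.2 0 0) (y p.1)) h); last exact: ch.
apply: continuous_scale_last => // {}p.
by apply: (@continuous_comp _ _ _ fst y); [exact: cvg_fst|exact: cy].
Qed.

Lemma continuous_last_average j h : continuous h -> continuous (last_average j h).
Proof.
move=> ch; apply: (continuous_mean lt_segment_ends
  (H := fun x z => z 0 0 ^+ j * h (scale_last (z 0 0) x))).
by apply: (@continuous_average_integrand _ j h id) => // x; exact: cvg_id.
Qed.

Lemma scale_last_set_coord (t s : R) x i :
  scale_last t (set_coord x i s) =
  set_coord (scale_last t x) i (if i == ord_max then t * s else s).
Proof.
apply/rowP => j; rewrite !mxE.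
have [->|jo] := eqVneq j ord_max; first by rewrite eq_sym; case: eqVneq.
by have [<-|//] := eqVneq j i; rewrite (negPf jo).
Qed.

Lemma is_derive_scaled (g : R -> R) (c s l : R) :
  is_derive (c * s) 1 g l -> is_derive s 1 (fun s => g (c * s)) (c * l).
Proof.
move=> dg.
have dc : is_derive s (1 : R) (fun s => c * s) c.
  by have := is_deriveZ c (is_derive_id s (1 : R)); rewrite /GRing.scale/= mulr1.
rewrite [c * l]mulrC.
exact: (@is_derive1_comp R g (fun s => c * s) s l c dg dc).
Qed.

Lemma partial_last_average i j h :
  continuous h -> (forall x, derivable h x (basis_vec R i)) ->
  continuous (partial i h) ->
  forall x, derivable (last_average j h) x (basis_vec R i) /\
    partial i (last_average j h) x =
    last_average (if i == ord_max then j.+1 else j) (partial i h) x.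
Proof.
move=> ch dh cdh x; set j' := if _ then _ else _.
apply: partial_of_line.
have := @is_derive_mean R 1 0 (const_mx 1) lt_segment_ends
  (fun s z => z 0 0 ^+ j * h (scale_last (z 0 0) (set_coord x i s)))
  (fun s z => z 0 0 ^+ j' * partial i h (scale_last (z 0 0) (set_coord x i s)))
  (x 0 i).
rewrite /last_average -[in X in _ -> is_derive _ _ _ X](set_coord_id x i); apply.
- by apply: continuous_average_integrand => //; exact: continuous_set_coord.
- by apply: continuous_average_integrand => //; exact: continuous_set_coord.
move=> z s; rewrite /j'; set t := z 0 0.
rewrite (_ : (fun _ => _) = fun s => t ^+ j *
    h (set_coord (scale_last t x) i (if i == ord_max then t * s else s))); last first.
  by apply/funext => r; rewrite scale_last_set_coord.
rewrite scale_last_set_coord.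
case: eqP => _; last exact/is_deriveZ/is_derive_partial.
rewrite exprSr -mulrA; apply: is_deriveZ.
exact/(@is_derive_scaled (fun s => h (set_coord _ i s)))/is_derive_partial.
Qed.

Lemma class_C_continuous k f : class_C k f -> continuous f.
Proof. by case: k => [//|k []]. Qed.

Lemma class_C_pred k f : class_C k.+1 f -> class_C k f.
Proof.
elim: k f => [f []//|k IH f [cf df]]; split => // i.
by have [? ?] := df i; split => //; exact: IH.
Qed.

Lemma class_C_le k m f : (k <= m)%N -> class_C m f -> class_C k f.
Proof.
move=> /subnK <-; elim: (m - k)%N => [//|d IH] fC; apply: IH.
exact: class_C_pred.
Qed.

Lemma class_C_last_average k j h : class_C k h -> class_C k (last_average j h).
Proof.
elim: k j h => [|k IH] j h; first exact: continuous_last_average.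
move=> [ch dh]; split; first exact: continuous_last_average.
move=> i; have [dhi Chi] := dh i.
have PE := @partial_last_average i j h ch dhi (class_C_continuous Chi).
split; first by move=> x; have [] := PE x.
rewrite (_ : partial i _ =
  last_average (if i == ord_max then j.+1 else j) (partial i h)); first exact: IH.
by apply/funext => x; have [] := PE x.
Qed.

Lemma class_CD k f h : class_C k f -> class_C k h -> class_C k (fun x => f x + h x).
Proof.
elim: k f h => [f h cf ch|k IH f h [cf df] [ch dh]]; first exact: continuous_funD.
split=> [|i]; first exact: continuous_funD.
have [dfi Cfi] := df i; have [dhi Chi] := dh i.
split=> [x|]; first exact: derivableD.
rewrite (_ : partial i _ = fun x => partial i f x + partial i h x); first exact: IH.
by apply/funext => x; rewrite /partial -deriveD.
Qed.

Lemma class_CZ k (c : R) f : class_C k f -> class_C k (fun x => c * f x).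
Proof.
have cc : continuous (cst c : 'rV[R]_n.+1 -> R) by exact: cst_continuous.
elim: k f => [f cf|k IH f [cf df]]; first exact: (continuous_funM cc cf).
split=> [|i]; first exact: (continuous_funM cc cf).
have [dfi Cfi] := df i.
split=> [x|]; first exact: derivableZ.
rewrite (_ : partial i _ = fun x => c * partial i f x); first exact: IH.
by apply/funext => x; exact: deriveZ.
Qed.

Lemma class_C_sum k (I : Type) (s : seq I) (F : I -> 'rV[R]_n.+1 -> R) :
  (forall i, class_C k (F i)) -> class_C k (fun x => \sum_(i <- s) F i x).
Proof.
move=> FC; elim: s => [|i s IH].
  rewrite (_ : (fun _ => _) = cst 0); last by apply/funext => x; rewrite big_nil.
  elim: k {FC} => [|k IH]; first exact: cst_continuous.
  split=> [|i]; first exact: cst_continuous.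
  split=> [x|]; first exact: derivable_cst.
  by rewrite (_ : partial i _ = cst 0)//; apply/funext => x; exact: derive_cst.
rewrite (_ : (fun _ => _) = fun x => F i x + \sum_(j <- s) F j x);
  first exact: class_CD.
by apply/funext => x; rewrite big_cons.
Qed.

Definition odd_last f := forall x, f (reflect_last x) = - f x.

Lemma reflect_last_set_coord x i (s : R) :
  reflect_last (set_coord x i s) =
  set_coord (reflect_last x) i (if i == ord_max then - s else s).
Proof.
apply/rowP => j; rewrite !mxE.
by case: (eqVneq j i) => [->|ji] //; case: eqVneq.
Qed.

Lemma derive_line f x i : partial i f x = 'D_1 (fun s => f (set_coord x i s)) (x 0 i).
Proof. by rewrite /derive set_coord_quotient set_coord_id. Qed.

Lemma even_partial f i : i != ord_max -> even_last f -> even_last (partial i f).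
Proof.
move=> /negPf io ef x; rewrite !derive_line mxE io.
rewrite (_ : (fun s : R => f (set_coord (reflect_last x) i s)) =
  fun s => f (set_coord x i s))//.
by apply/funext => s; rewrite -[RHS]ef reflect_last_set_coord io.
Qed.

Lemma partial_last_reflect (e : R) f :
  (forall x, f (reflect_last x) = e * f x) ->
  (forall x, derivable f x (basis_vec R ord_max)) ->
  forall x, partial ord_max f (reflect_last x) = - e * partial ord_max f x.
Proof.
move=> ef df x.
suff : is_derive (reflect_last x 0 ord_max) 1
    (fun s => f (set_coord (reflect_last x) ord_max s)) (- e * partial ord_max f x).
  by move=> /partial_of_line[].
rewrite (_ : (fun _ => _) = fun s => e * f (set_coord x ord_max (-1 * s)));
  last first.
  apply/funext => s; rewrite -ef reflect_last_set_coord eqxx mulN1r opprK//.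
rewrite mxE eqxx mulNr -mulrN -[- partial _ _ _]mulN1r; apply: is_deriveZ.
apply: (@is_derive_scaled (fun s => f (set_coord x ord_max s))).
rewrite mulN1r opprK -[X in is_derive _ _ _ (partial _ _ X)](set_coord_id x ord_max).
exact: is_derive_partial.
Qed.

Lemma odd_partial_last f : even_last f ->
  (forall x, derivable f x (basis_vec R ord_max)) -> odd_last (partial ord_max f).
Proof.
move=> ef df x; rewrite (@partial_last_reflect 1)// ?mulN1r// => y.
by rewrite ef mul1r.
Qed.

Lemma even_partial_last f : odd_last f ->
  (forall x, derivable f x (basis_vec R ord_max)) -> even_last (partial ord_max f).
Proof.
move=> ef df x; rewrite (@partial_last_reflect (-1))// ?opprK ?mul1r// => y.
by rewrite ef mulN1r.
Qed.

Lemma odd_last_eq0 f x : odd_last f -> x 0 ord_max = 0 -> f x = 0.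
Proof.
move=> of_ x0; have := of_ x; rewrite (_ : reflect_last x = x); first by lra.
by apply/rowP => j; rewrite mxE; case: eqP => // ->; rewrite x0 oppr0.
Qed.

Lemma even_second_partial f i : class_C 2 f -> even_last f ->
  even_last (partial i (partial i f)).
Proof.
move=> [_ df] ef; have [dfi [_ ddfi]] := df i; have [ddfii _] := ddfi i.
have [io|io] := eqVneq i ord_max; last by do 2!apply: even_partial => //.
by subst i; apply: even_partial_last => //; exact: odd_partial_last.
Qed.

(** Since f_y vanishes at y = 0 by oddness, f_y / y is the mean of the derivative
of t |-> f_y(x', t y) / y. *)
Lemma singular_term_average f : class_C 2 f -> even_last f ->
  singular_term f = last_average 0 (partial ord_max (partial ord_max f)).
Proof.
move=> [cf df] ef; have [dfl [cfl ddfl]] := df ord_max.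
have [ddfll cddf] := ddfl ord_max.
have ofl := odd_partial_last ef dfl.
set F := partial ord_max (partial ord_max f).
apply/funext => x; rewrite /singular_term /last_average /segment_mean.
set y := x 0 ord_max; have [y0|y0] := eqVneq y 0.
  rewrite (_ : (fun _ => _) = fun=> F x); first by rewrite mean_cst.
  apply/funext => z; rewrite expr0 mul1r; congr F.
  by rewrite /scale_last -/y y0 mulr0 -[X in set_coord _ _ X]y0 set_coord_id.
rewrite (_ : (fun _ => _) = fun z : 'rV[R]_1 => F (scale_last (z 0 0) x)); last first.
  by apply/funext => z; rewrite expr0 mul1r.
have c0 : continuous (fun z : 'rV[R]_1 => z 0 0) by exact: coord_continuous.
have cx : continuous (fun _ : 'rV[R]_1 => x) by exact: cst_continuous.
have cs := continuous_scale_last c0 cx.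
transitivity (y^-1 * partial ord_max f x /
  ((const_mx 1 : 'rV[R]_1) 0 0 - (0 : 'rV[R]_1) 0 0)).
  by rewrite !mxE subr0 divr1.
apply/esym/(mean_partial lt_segment_ends
  (G := fun z => y^-1 * partial ord_max f (scale_last (z 0 0) x))).
- by move=> z; apply: continuous_comp; [exact: cs|exact: cddf].
- apply: continuous_funM; first exact: cst_continuous.
  by move=> z; apply: continuous_comp; [exact: cs|exact: cfl].
- move=> z _ t _.
  rewrite (_ : (fun _ => _) = fun s => y^-1 *
    partial ord_max f (set_coord x ord_max (y * s))); last first.
    by apply/funext => s; rewrite mxE eqxx /scale_last -/y mulrC [y * s]mulrC mulrC.
  rewrite mxE eqxx /scale_last -/y (mulrC t).
  rewrite -[F _](mulKf y0); apply: is_deriveZ.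
  apply: (@is_derive_scaled (fun s => partial ord_max f (set_coord x ord_max s))).
  exact: is_derive_partial.
- move=> z _; rewrite !mxE/= /scale_last mul1r set_coord_id mul0r.
  by rewrite [X in _ - _ * X]odd_last_eq0 ?mulr0 ?subr0// mxE eqxx.
Qed.

Lemma class_C_laplacian (a : R) k f : class_C k.+2 f -> even_last f ->
  class_C k (weighted_laplacian a f).
Proof.
move=> fC ef; have fC2 : class_C 2 f by apply: class_C_le fC.
have [cf df] := fC.
have dd i : class_C k (partial i (partial i f)).
  by have [_ [_ ddf]] := df i; have [] := ddf i.
apply: class_CD; first exact: class_C_sum.
by apply: class_CZ; rewrite singular_term_average//; exact: class_C_last_average.
Qed.

Lemma even_laplacian (a : R) f : class_C 2 f -> even_last f ->
  even_last (weighted_laplacian a f).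
Proof.
move=> fC ef x; have [_ df] := fC; have [dfl _] := df ord_max.
have sE : singular_term f (reflect_last x) = singular_term f x.
  rewrite /singular_term mxE eqxx oppr_eq0; case: eqP => _.
    exact: even_second_partial.
  by rewrite odd_partial_last// invrN mulrNN.
have bE : \sum_(i < n.+1) partial i (partial i f) (reflect_last x) =
    \sum_(i < n.+1) partial i (partial i f) x.
  by apply: eq_bigr => i _; rewrite even_second_partial.
exact: (f_equal2 (fun p q => p + (2 * a - 1) * q) bE sE).
Qed.

End LastCoordinateAverage.

(** * Derivatives of truncated powers *)

Section OneVariable.
Context {R : realType}.
Implicit Types (f g : R -> R) (t : R).

Lemma is_derive_funD f g t (df dg : R) : is_derive t 1 f df -> is_derive t 1 g dg ->
  is_derive t 1 (fun s => f s + g s) (df + dg).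
Proof. by move=> ? ?; exact: is_deriveD. Qed.

Lemma is_derive_funM f g t (df dg : R) : is_derive t 1 f df -> is_derive t 1 g dg ->
  is_derive t 1 (fun s => f s * g s) (df * g t + f t * dg).
Proof.
move=> Df Dg; have := @is_deriveM _ _ f g t 1 df dg Df Dg.
by rewrite /GRing.scale/= [g t * _]mulrC addrC.
Qed.

Lemma is_derive_funcomp f g t (df dg : R) : is_derive (g t) 1 f df ->
  is_derive t 1 g dg -> is_derive t 1 (fun s => f (g s)) (df * dg).
Proof. by move=> Df Dg; exact: (is_derive1_comp Df Dg). Qed.

Lemma is_derive_fun_eq f t (df df' : R) :
  is_derive t 1 f df -> df = df' -> is_derive t 1 f df'.
Proof. by move=> ? <-. Qed.

Lemma is_derive_const (c t : R) : is_derive t 1 (fun=> c) 0.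
Proof. exact: is_derive_cst. Qed.

(** The product with the identity is differentiable at 0 although [f] is only
continuous there; this handles the corner of the truncated powers. *)
Lemma is_derive_mul_id f : {for 0, continuous f} ->
  is_derive (0 : R) 1 (fun s => s * f s) (f 0).
Proof.
move=> cf.
suff qf : (fun h : R => h^-1 *: (((fun s => s * f s) \o shift 0) (h *: (1 : R)) -
    0 * f 0)) @ 0^' --> f 0.
  by split; [apply/cvg_ex; exists (f 0)|exact: cvg_lim].
apply/cvgrPdist_lt => e e0; have /cvgr_dist_lt/(_ _ e0) fe := cf.
near=> h; have h0 : h != 0 by near: h; exact: nbhs_dnbhs_neq.
rewrite /= addr0 [h *: 1]mulr1 mul0r subr0 [h^-1 *: _]mulKf//.
by near: h; exact: nbhs_dnbhs.
Unshelve. all: end_near.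
Qed.

Lemma continuous_pos_part : continuous (fun t => Num.max 0 t).
Proof. by move=> t; apply: continuous_max; [exact: cst_continuous|exact: cvg_id]. Qed.

Lemma is_derive_pos_part_pow k t :
  is_derive t 1 (fun s => Num.max 0 s ^+ k.+2) (k.+2%:R * Num.max 0 t ^+ k.+1).
Proof.
have [->|] := eqVneq t 0.
  rewrite maxxx expr0n/= mulr0.
  rewrite (_ : (fun _ => _) = fun s => s * Num.max 0 s ^+ k.+1); last first.
    by apply/funext => s; rewrite exprS; case: (leP 0 s) => _ //;
      rewrite expr0n/= !mulr0.
  apply: is_derive_fun_eq (@is_derive_mul_id (fun s => Num.max 0 s ^+ k.+1) _) _.
    exact: (continuous_funX continuous_pos_part).
  by rewrite maxxx expr0n.
rewrite neq_lt => /orP[] t0.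
  rewrite max_l ?(ltW t0)// expr0n/= mulr0.
  apply: (@near_eq_is_derive _ _ _ (cst 0)).
  by near do rewrite /= max_l ?expr0n//; exact: lt_le_nbhsl.
rewrite max_r ?(ltW t0)//.
apply: (@near_eq_is_derive R R R (fun s : R => s ^+ k.+2)).
  by near do rewrite /= max_r ?ltW//; exact: lt_nbhsr.
split; first exact: exprn_derivable.
by rewrite exp_derive; exact: mulr1.
Unshelve. all: end_near.
Qed.

Definition pos_pow (e t : R) : R := Num.max 0 t `^ e.

Lemma pos_pow_ge0 e t : 0 <= pos_pow e t.
Proof. exact: powR_ge0. Qed.

Lemma pos_pow_gt0 e t : 0 < t -> 0 < pos_pow e t.
Proof. by move=> t0; rewrite powR_gt0// lt_max t0 orbT. Qed.

Lemma is_derive_mul_pos_pow e t : 0 < t ->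
  is_derive t 1 (fun s => s * pos_pow e s) ((e + 1) * pos_pow e t).
Proof.
move=> t0; apply: (@near_eq_is_derive R R R (fun s : R => s * s `^ e)).
  by near do rewrite /pos_pow /= max_r ?ltW//; exact: lt_nbhsr.
apply: is_derive_fun_eq (is_derive_funM (is_derive_id _ _) (is_derive1_powR e t0)) _.
rewrite /pos_pow max_r ?ltW// powRB ?(gt_eqF t0) ?implybT// powRr1 ?ltW//.
by field; rewrite gt_eqF.
Unshelve. all: end_near.
Qed.

Lemma continuous_pos_pow e : 0 <= e -> continuous (pos_pow e).
Proof.
rewrite le_eqVlt => /predU1P[<-|e0].
  rewrite (_ : pos_pow 0 = cst 1); first exact: cst_continuous.
  by apply/funext => t; rewrite /pos_pow powRr0.
move=> t; have [t0|t0] := ltP 0 t.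
  apply/differentiable_continuous/derivable1_diffP.
  have [] // := @near_eq_is_derive R R R (fun s : R => s `^ e) (pos_pow e) t 1 _ _
    (is_derive1_powR e t0).
  by near do rewrite /pos_pow /= max_r ?ltW//; exact: lt_nbhsr.
apply/cvgrPdist_lt => eps eps0; near=> s.
have -> : pos_pow e t = 0 by rewrite /pos_pow max_l// powR0 ?gt_eqF.
rewrite sub0r normrN ger0_norm ?pos_pow_ge0//.
have epsE : eps = (eps `^ e^-1) `^ e by rewrite -powRrM mulVf ?gt_eqF// powRr1// ltW.
rewrite epsE; apply: gt0_ltr_powR => //; rewrite ?nnegrE ?powR_ge0 ?le_max ?lexx//.
rewrite gt_max powR_gt0//=; near: s; apply: lt_nbhsl.
by rewrite (le_lt_trans t0)// powR_gt0.
Unshelve. all: end_near.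
Qed.

(** The field F' P^m - F (P^m)' of Green's second identity on a line, with
m = k + 3 and P = max(0, 1 - S / c): the terms in F' P' cancel. *)
Lemma is_derive_green (F F1 F2 S S1 : R -> R) (k : nat) (c t S2 : R) :
  let P s := Num.max 0 (1 - S s / c) in
  is_derive t 1 F (F1 t) -> is_derive t 1 F1 (F2 t) ->
  is_derive t 1 S (S1 t) -> is_derive t 1 S1 S2 ->
  is_derive t 1
    (fun s => F1 s * P s ^+ k.+3 + F s * (k.+3%:R * P s ^+ k.+2 * (S1 s / c)))
    (F2 t * P t ^+ k.+3 - F t * (k.+3%:R * k.+2%:R * P t ^+ k.+1 * (S1 t / c) ^+ 2
       - k.+3%:R * P t ^+ k.+2 * (S2 / c))).
Proof.
move=> P dF dF1 dS dS1.
have dSc : is_derive t 1 (fun s => 1 - S s / c) (- (S1 t / c)).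
  rewrite (_ : (fun _ => _) = fun s => 1 + S s * - c^-1); last first.
    by apply/funext => s; rewrite mulrN.
  apply: is_derive_fun_eq (is_derive_funD (is_derive_const 1 t)
    (is_derive_funM dS (is_derive_const (- c^-1) t))) _.
  by rewrite /cst; ring.
have dP m : is_derive t 1 (fun s => P s ^+ m.+2)
    (m.+2%:R * P t ^+ m.+1 * - (S1 t / c)).
  exact: (@is_derive_funcomp (fun s => Num.max 0 s ^+ m.+2)
    (fun s => 1 - S s / c) _ _ _ (is_derive_pos_part_pow m _) dSc).
apply: is_derive_fun_eq (is_derive_funD (is_derive_funM dF1 (dP k.+1))
  (is_derive_funM dF (is_derive_funM (is_derive_funM (is_derive_const k.+3%:R t) (dP
    k))
     (is_derive_funM dS1 (is_derive_const c^-1 t))))) _.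
rewrite /cst; move: (P t) (F t) (F1 t) (F2 t) (S1 t) => p f f1 f2 s1.
by rewrite !(mulrA k.+3%:R); set x := k.+3%:R; set y := k.+2%:R; ring.
Qed.

End OneVariable.

(** * The averaging kernel *)

Section Kernel.
Context {R : realType} {n : nat}.
Variables (a r : R) (c : 'rV[R]_n.+1).
Hypotheses (a1 : 1 <= a) (r0 : 0 < r) (c0 : 0 <= c 0 ord_max).
Implicit Types (z : 'rV[R]_n.+2) (x : 'rV[R]_n.+1) (f : 'rV[R]_n.+1 -> R)
  (i : 'I_n.+1) (theta t : R).

(** The kernel lives on n + 2 variables: the n + 1 coordinates of a point and
then an angle in [[0, pi]]. *)
Definition space_part z : 'rV[R]_n.+1 := \row_i z 0 (lift ord_max i).
Definition angle z : R := z 0 ord_max.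

Definition lower_corner : 'rV[R]_n.+2 :=
  \row_j oapp (fun i => if i == ord_max then 0 else c 0 i - r) 0 (unlift ord_max j).
Definition upper_corner : 'rV[R]_n.+2 :=
  \row_j oapp (fun i => c 0 i + r) pi (unlift ord_max j).

Lemma lt_corners j : lower_corner 0 j < upper_corner 0 j.
Proof.
rewrite !mxE; case: unliftP => [i _|_] /=; last exact: pi_gt0.
case: eqP => [->|_]; first by rewrite ltr_wpDl.
by move: r0; lra.
Qed.

Lemma space_part_set_lift z i t :
  space_part (set_coord z (lift ord_max i) t) = set_coord (space_part z) i t.
Proof. by apply/rowP => j; rewrite !mxE (inj_eq lift_inj). Qed.

Lemma angle_set_lift z i t : angle (set_coord z (lift ord_max i) t) = angle z.
Proof. by rewrite /angle mxE (negPf (neq_lift _ _)). Qed.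

Lemma space_part_set_max z t : space_part (set_coord z ord_max t) = space_part z.
Proof. by apply/rowP => j; rewrite !mxE eq_sym (negPf (neq_lift _ _)). Qed.

Lemma angle_set_max z t : angle (set_coord z ord_max t) = t.
Proof. by rewrite /angle mxE eqxx. Qed.

Lemma corner_lift i : lower_corner 0 (lift ord_max i) =
    (if i == ord_max then 0 else c 0 i - r) /\
  upper_corner 0 (lift ord_max i) = c 0 i + r.
Proof. by rewrite !mxE liftK. Qed.

Lemma corner_max : lower_corner 0 ord_max = 0 /\ upper_corner 0 ord_max = pi.
Proof. by rewrite !mxE unlift_none. Qed.

Definition kernel_box := half_open_box lower_corner upper_corner.

Lemma kernel_box_height z : kernel_box z -> 0 < space_part z 0 ord_max.
Proof.
by move=> /(_ (lift ord_max ord_max)); rewrite !mxE liftK/= eqxx => /andP[].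
Qed.

(** |x' - c'|^2 + y^2 + c_y^2 - 2 y c_y cos theta: the squared distance from the
center of a point at height y turned by the angle theta. *)
Definition sq_dist x (theta : R) : R :=
  \sum_i (x 0 i - c 0 i) ^+ 2 + 2 * x 0 ord_max * c 0 ord_max * (1 - cos theta).

Definition partial_sq_dist (i : 'I_n.+1) x (theta : R) : R :=
  2 * (x 0 i - c 0 i) +
  (if i == ord_max then 2 * c 0 ord_max * (1 - cos theta) else 0).

Definition bump x theta : R := Num.max 0 (1 - sq_dist x theta / r ^+ 2).

(** y^(2a-1) (sin theta)^(2a-2), with the first factor split as y times
y^(2a-2); both truncated powers are continuous as soon as a >= 1. *)
Definition weight x theta : R :=
  x 0 ord_max * pos_pow (2 * a - 2) (x 0 ord_max) * pos_pow (2 * a - 2) (sin theta).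

Lemma weight_exponent_ge0 : 0 <= 2 * a - 2.
Proof. by move: a1; lra. Qed.

Lemma bump_ge0 x theta : 0 <= bump x theta.
Proof. by rewrite le_max lexx. Qed.

Lemma sq_dist_ge0 x theta : 0 <= x 0 ord_max -> 0 <= sq_dist x theta.
Proof.
move=> x0; rewrite addr_ge0//; first by apply: sumr_ge0 => i _; rewrite sqr_ge0.
by rewrite !mulr_ge0// subr_ge0 cos_le1.
Qed.

Lemma coord_sq_dist x theta i : 0 <= x 0 ord_max ->
  (x 0 i - c 0 i) ^+ 2 <= sq_dist x theta.
Proof.
move=> x0; rewrite /sq_dist (bigD1 i)//= -addrA lerDl addr_ge0//.
  by apply: sumr_ge0 => j _; rewrite sqr_ge0.
by rewrite !mulr_ge0// subr_ge0 cos_le1.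
Qed.

Lemma bump_le1 x theta : 0 <= x 0 ord_max -> bump x theta <= 1.
Proof.
move=> x0; rewrite ge_max ler01 lerBlDr lerDl divr_ge0 ?sq_dist_ge0//.
exact: sqr_ge0.
Qed.

(** The box has half-width r, so the bump vanishes on all of its faces except
the bottom y = 0 and the two angular faces. *)
Lemma bump_face x theta i : 0 <= x 0 ord_max -> r <= `|x 0 i - c 0 i| ->
  bump x theta = 0.
Proof.
move=> x0 rx; rewrite /bump max_l// subr_le0 ler_pdivlMr ?exprn_gt0// mul1r.
apply: le_trans (coord_sq_dist theta i x0).
by rewrite -[leRHS]real_normK ?num_real// ler_sqr ?nnegrE// ltW.
Qed.

(** Where the bump vanishes both sides are 0; elsewhere s / r^2 = 1 - bump. *)
Lemma bumpM k x theta :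
  bump x theta ^+ k.+1 * (sq_dist x theta / r ^+ 2) =
  bump x theta ^+ k.+1 - bump x theta ^+ k.+2.
Proof.
rewrite [in X in _ = _ - X]exprSr -[X in X - _]mulr1 -mulrBr.
rewrite /bump; have [_|lt0] := leP 0 (1 - sq_dist x theta / r ^+ 2);
  first by congr (_ * _); ring.
by rewrite expr0n/= !mul0r.
Qed.

Lemma weight_ge0 x theta : 0 <= x 0 ord_max -> 0 <= weight x theta.
Proof. by move=> x0; rewrite !mulr_ge0// pos_pow_ge0. Qed.

Lemma continuous_space_comp f : continuous f -> continuous (fun z => f (space_part
  z)).
Proof.
move=> cf z; apply: (@continuous_comp _ _ _ space_part f); last exact: cf.
apply: continuous_row => i.
rewrite (_ : (fun _ => _) = fun z => z 0 (lift ord_max i));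
  first exact: coord_continuous.
by apply/funext => z'; rewrite mxE.
Qed.

Lemma continuous_space_coord i : continuous (fun z => space_part z 0 i).
Proof. by apply: (continuous_space_comp (f := fun x => x 0 i));
  exact: coord_continuous. Qed.

Lemma continuous_cos_angle : continuous (fun z => cos (angle z)).
Proof. by apply: continuous_funcomp; [exact: continuous_cos
  |exact: coord_continuous]. Qed.

Lemma continuous_sin_angle : continuous (fun z => sin (angle z)).
Proof. by apply: continuous_funcomp; [exact: continuous_sin
  |exact: coord_continuous]. Qed.

Lemma continuous_sq_dist : continuous (fun z => sq_dist (space_part z) (angle z)).
Proof.
have cc := continuous_cos_angle; have cs := continuous_space_coord.
apply: continuous_funD; last by solve_continuous; exact: cs.
by apply: continuous_fun_sum => i _; solve_continuous; exact: cs.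
Qed.

Lemma continuous_partial_sq_dist i :
  continuous (fun z => partial_sq_dist i (space_part z) (angle z)).
Proof.
have cc := continuous_cos_angle; have cs := continuous_space_coord.
apply: continuous_funD; first by solve_continuous; exact: cs.
by case: eqP => _; solve_continuous.
Qed.

Lemma continuous_bump : continuous (fun z => bump (space_part z) (angle z)).
Proof.
apply: (continuous_funcomp continuous_pos_part).
by have := continuous_sq_dist => ?; solve_continuous.
Qed.

Lemma continuous_height_pow :
  continuous (fun z => pos_pow (2 * a - 2) (space_part z 0 ord_max)).
Proof.
apply: (continuous_funcomp (continuous_pos_pow weight_exponent_ge0)).
exact: continuous_space_coord.
Qed.

Lemma continuous_sin_pow :
  continuous (fun z => pos_pow (2 * a - 2) (sin (angle z))).
Proof.
apply: (continuous_funcomp (continuous_pos_pow weight_exponent_ge0)).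
exact: continuous_sin_angle.
Qed.

Lemma continuous_weight : continuous (fun z => weight (space_part z) (angle z)).
Proof.
have := continuous_height_pow; have := continuous_sin_pow => ? ?.
have := continuous_space_coord (i := ord_max) => ?.
by rewrite /weight; solve_continuous.
Qed.

(** The exponent is shifted because Green's identity for bump^(k+3) leads down to
bump^(k+1), which still has to be continuous. *)
Definition kernel_mean (k : nat) f : R :=
  mean lower_corner upper_corner (fun z =>
    weight (space_part z) (angle z) * bump (space_part z) (angle z) ^+ k.+1 *
    f (space_part z)).

Lemma is_derive_sq_dist i x theta t :
  is_derive t 1 (fun s => sq_dist (set_coord x i s) theta)
    (partial_sq_dist i (set_coord x i t) theta).
Proof.
pose q := \sum_(j | j != i) (x 0 j - c 0 j) ^+ 2.
have cs (l : R) : is_derive t 1 (fun s : R => s - l) 1.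
  by apply: is_derive_fun_eq (is_derive_funD (is_derive_id t 1) (is_derive_const (-
    l) t)) _; rewrite addr0.
pose h (s : R) := if i == ord_max then s else x 0 ord_max.
have dh : is_derive t 1 h (if i == ord_max then 1 else 0).
  by rewrite /h; case: eqP => _; [exact: is_derive_id|exact: is_derive_const].
rewrite (_ : (fun _ => _) = fun s => ((s - c 0 i) * (s - c 0 i) + q) +
   h s * (2 * c 0 ord_max * (1 - cos theta))); last first.
  apply/funext => s; rewrite /sq_dist (bigD1 i)//= !mxE eqxx expr2; congr (_ + _ + _).
    by apply: eq_bigr => j /negPf ji; rewrite mxE ji.
  by rewrite eq_sym /h; ring.
apply: is_derive_fun_eq (is_derive_funD (is_derive_funD
  (is_derive_funM (cs _) (cs _)) (is_derive_const q t))
  (is_derive_funM dh (is_derive_const (2 * c 0 ord_max * (1 - cos theta)) t))) _.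
by rewrite /partial_sq_dist mxE eqxx; case: eqP => _; ring.
Qed.

Lemma is_derive_partial_sq_dist i x theta t :
  is_derive t 1 (fun s => partial_sq_dist i (set_coord x i s) theta) 2.
Proof.
set e := if i == ord_max then 2 * c 0 ord_max * (1 - cos theta) else 0.
rewrite (_ : (fun _ => _) = fun s => 2 * s + (e - 2 * c 0 i)); last first.
  by apply/funext => s; rewrite /partial_sq_dist -/e mxE eqxx; ring.
apply: is_derive_fun_eq (is_derive_funD (is_derive_funM (is_derive_const 2 t)
  (is_derive_id t 1)) (is_derive_const (e - 2 * c 0 i) t)) _.
by ring.
Qed.

Definition green_field k f (i : 'I_n.+1) x theta : R :=
  partial i f x * bump x theta ^+ k.+3 +
  f x * (k.+3%:R * bump x theta ^+ k.+2 * (partial_sq_dist i x theta / r ^+ 2)).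

Definition green_divergence k f (i : 'I_n.+1) x theta : R :=
  partial i (partial i f) x * bump x theta ^+ k.+3 -
  f x * (k.+3%:R * k.+2%:R * bump x theta ^+ k.+1 *
         (partial_sq_dist i x theta / r ^+ 2) ^+ 2 -
         k.+3%:R * bump x theta ^+ k.+2 * (2 / r ^+ 2)).

Lemma is_derive_green_field k f i x theta t : class_C 2 f ->
  is_derive t 1 (fun s => green_field k f i (set_coord x i s) theta)
    (green_divergence k f i (set_coord x i t) theta).
Proof.
move=> [_ df]; have [dfi [_ ddf]] := df i; have [ddfi _] := ddf i.
apply: (@is_derive_green R (fun s => f (set_coord x i s))
  (fun s => partial i f (set_coord x i s))
  (fun s => partial i (partial i f) (set_coord x i s))
  (fun s => sq_dist (set_coord x i s) theta)
  (fun s => partial_sq_dist i (set_coord x i s) theta)).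
- exact: is_derive_partial.
- exact: is_derive_partial.
- exact: is_derive_sq_dist.
- exact: is_derive_partial_sq_dist.
Qed.

Lemma green_field_face k f i x theta : 0 <= x 0 ord_max ->
  r <= `|x 0 i - c 0 i| -> green_field k f i x theta = 0.
Proof.
by move=> x0 rx; rewrite /green_field (bump_face theta x0 rx) !expr0n/= !(mulr0,
  mul0r, addr0).
Qed.

End Kernel.

(** * Green's identity for the kernel *)

Section GreenIdentity.
Context {R : realType} {n : nat}.
Variables (a r : R) (c : 'rV[R]_n.+1).
Hypotheses (a1 : 1 <= a) (r0 : 0 < r) (c0 : 0 <= c 0 ord_max).
Variables (k : nat) (f : 'rV[R]_n.+1 -> R).
Hypotheses (fC : class_C 2 f) (fe : even_last f).
Implicit Types (z : 'rV[R]_n.+2) (i : 'I_n.+1).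

Local Notation x_ z := (space_part z).
Local Notation h_ z := (space_part z 0 ord_max).
Local Notation bump_ z := (bump r c (space_part z) (angle z)).
Local Notation weight_ z := (weight a (space_part z) (angle z)).
Local Notation hpow z := (pos_pow (2 * a - 2) (space_part z 0 ord_max)).
Local Notation spow z := (pos_pow (2 * a - 2) (sin (angle z))).
Local Notation kmean := (mean (lower_corner r c) (upper_corner r c)).

(** The derivative of weight * [green_field] in the coordinate [i]; only the last
coordinate enters the weight. *)
Definition space_divergence i z : R :=
  weight_ z * green_divergence r c k f i (x_ z) (angle z) +
  (if i == ord_max then
     (2 * a - 1) * hpow z * spow z * green_field r c k f i (x_ z) (angle z)
   else 0).

(** Off the hyperplane the derivatives in space alone do not produce a function
of the distance: the discrepancy is the angular derivative of this field. *)
Definition angular_field z : R :=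
  2 * k.+3%:R * c 0 ord_max / r ^+ 2 * hpow z * f (x_ z) *
  (bump_ z ^+ k.+2 * (sin (angle z) * spow z)).

Definition angular_divergence z : R :=
  2 * k.+3%:R * c 0 ord_max / r ^+ 2 * hpow z * f (x_ z) *
  (k.+2%:R * bump_ z ^+ k.+1 *
     (- (2 * h_ z * c 0 ord_max * sin (angle z) / r ^+ 2)) *
     (sin (angle z) * spow z) +
   bump_ z ^+ k.+2 * ((2 * a - 1) * spow z * cos (angle z))).

Lemma continuous_green i :
  continuous (fun z => green_field r c k f i (x_ z) (angle z)) /\
  continuous (fun z => green_divergence r c k f i (x_ z) (angle z)).
Proof.
have [cf df] := fC; have [_ [cdf ddf]] := df i; have [_ cddf] := ddf i.
have cB : continuous (fun z => bump_ z) by exact: continuous_bump.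
have cD : continuous (fun z => partial_sq_dist c i (x_ z) (angle z)).
  exact: continuous_partial_sq_dist.
have c1 := continuous_space_comp cf; have c2 := continuous_space_comp cdf.
have c3 := continuous_space_comp cddf.
by rewrite /green_field /green_divergence; split; solve_continuous.
Qed.

(** The flux through each face is 0: the bump vanishes there, except at the
bottom y = 0, where the weight does. *)
Lemma mean_space_divergence i : kmean (space_divergence i) = 0.
Proof.
have [cG cD] := continuous_green i.
have cw : continuous (fun z => weight_ z) by exact: continuous_weight.
have cy : continuous (fun z => hpow z) by exact: continuous_height_pow.
have cs : continuous (fun z => spow z) by exact: continuous_sin_pow.
transitivity (0 / (upper_corner r c 0 (lift ord_max i) -
  lower_corner r c 0 (lift ord_max i))); last by rewrite mul0r.
apply: (mean_partial (lt_corners r0 c0)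
  (G := fun z => weight_ z * green_field r c k f i (x_ z) (angle z))).
- apply: continuous_funD; first exact: continuous_funM.
  by case: eqP => _; [repeat apply: continuous_funM => //;
    exact: cst_continuous|exact: cst_continuous].
- exact: continuous_funM.
- move=> z zb t; have [-> ->] := corner_lift r c i => /andP[lt tu].
  set x := x_ z; set th := angle z.
  rewrite (_ : (fun _ => _) = fun s => weight a (set_coord x i s) th *
    green_field r c k f i (set_coord x i s) th); last first.
    by apply/funext => s; rewrite space_part_set_lift angle_set_lift.
  rewrite /space_divergence space_part_set_lift angle_set_lift -/x -/th.
  have dG := is_derive_green_field r c k i x th t fC.
  have dw : is_derive t 1 (fun s => weight a (set_coord x i s) th)
      (if i == ord_max then (2 * a - 1) * pos_pow (2 * a - 2) t *
         pos_pow (2 * a - 2) (sin th) else 0).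
    case: (eqVneq i ord_max) lt => [-> t0|io _].
      rewrite (_ : (fun _ => _) = fun s => s * pos_pow (2 * a - 2) s *
        pos_pow (2 * a - 2) (sin th)); last first.
        by apply/funext => s; rewrite /weight mxE eqxx.
      apply: is_derive_fun_eq (is_derive_funM (is_derive_mul_pos_pow (2 * a - 2) t0)
        (is_derive_const (pos_pow (2 * a - 2) (sin th)) t)) _.
      by ring.
    rewrite (_ : (fun _ => _) = fun=> weight a x th); first exact: is_derive_const.
    by apply/funext => s; rewrite /weight mxE eq_sym (negPf io).
  apply: is_derive_fun_eq (is_derive_funM dw dG) _; rewrite addrC; congr (_ + _).
  by case: eqP => [->|_]; [rewrite mxE eqxx|rewrite mul0r].
- move=> z zb; have [-> ->] := corner_lift r c i.
  have h0 := kernel_box_height zb.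
  rewrite !space_part_set_lift !angle_set_lift; set x := x_ z in h0 *.
  have hE (s : R) : set_coord x i s 0 ord_max = if i == ord_max then s else x 0
    ord_max.
    by rewrite mxE eq_sym.
  rewrite [X in _ * X - _]green_field_face//.
  + case: (eqVneq i ord_max) => io; first by rewrite /weight !hE io eqxx !mul0r mulr0
    subr0.
    rewrite [X in _ - _ * X]green_field_face ?mulr0 ?subr0//.
      by rewrite hE (negPf io) ltW.
    by rewrite mxE eqxx addrAC subrr sub0r normrN ger0_norm// ltW.
  + by rewrite hE; case: eqP => [->|_]; [rewrite addr_ge0// ltW|exact: ltW].
  + by rewrite mxE eqxx addrAC subrr add0r ger0_norm// ltW.
Qed.

Lemma continuous_angular_divergence : continuous angular_divergence.
Proof.
have [cf _] := fC; have c1 := continuous_space_comp cf.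
have cB : continuous (fun z => bump_ z) by exact: continuous_bump.
have cy : continuous (fun z => hpow z) by exact: continuous_height_pow.
have cs : continuous (fun z => spow z) by exact: continuous_sin_pow.
have csin := @continuous_sin_angle R n; have ccos := @continuous_cos_angle R n.
have ch : continuous (fun z => h_ z) by exact: continuous_space_coord.
by rewrite /angular_divergence; solve_continuous.
Qed.

(** The angular flux is 0 because sin vanishes at 0 and pi. *)
Lemma mean_angular_divergence : kmean angular_divergence = 0.
Proof.
have [cf _] := fC; have c1 := continuous_space_comp cf.
have cB : continuous (fun z => bump_ z) by exact: continuous_bump.
have cy : continuous (fun z => hpow z) by exact: continuous_height_pow.
have cs : continuous (fun z => spow z) by exact: continuous_sin_pow.
have csin := @continuous_sin_angle R n.
transitivity (0 / (upper_corner r c 0 ord_max - lower_corner r c 0 ord_max));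
  last by rewrite mul0r.
apply: (mean_partial (lt_corners r0 c0) (G := angular_field)).
- exact: continuous_angular_divergence.
- by rewrite /angular_field; solve_continuous.
- move=> z zb t; have [-> ->] := corner_max r c => /andP[t0 tpi].
  set x := x_ z; set C := 2 * k.+3%:R * c 0 ord_max / r ^+ 2 *
    pos_pow (2 * a - 2) (x 0 ord_max) * f x.
  rewrite (_ : (fun _ => _) = fun s => C * (bump r c x s ^+ k.+2 *
    (sin s * pos_pow (2 * a - 2) (sin s)))); last first.
    by apply/funext => s; rewrite /angular_field space_part_set_max angle_set_max.
  rewrite /angular_divergence space_part_set_max angle_set_max -/x -/C.
  pose B := 2 * x 0 ord_max * c 0 ord_max.
  have dS : is_derive t 1 (fun s => 1 - sq_dist c x s / r ^+ 2) (- (B * sin t / r ^+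
    2)).
    pose A := \sum_i (x 0 i - c 0 i) ^+ 2.
    rewrite (_ : (fun _ => _) = fun s => (1 - (A + B) / r ^+ 2) + B / r ^+ 2 * cos
      s); last first.
      by apply/funext => s; rewrite /sq_dist -/A -/B; field; rewrite gt_eqF.
    apply: is_derive_fun_eq (is_derive_funD (is_derive_const (1 - (A + B) / r ^+ 2) t)
      (is_derive_funM (is_derive_const (B / r ^+ 2) t) (is_derive_cos t))) _.
    by field; rewrite gt_eqF.
  have dB : is_derive t 1 (fun s => bump r c x s ^+ k.+2)
      (k.+2%:R * bump r c x t ^+ k.+1 * - (B * sin t / r ^+ 2)).
    exact: (@is_derive_funcomp _ (fun s => Num.max 0 s ^+ k.+2)
      (fun s => 1 - sq_dist c x s / r ^+ 2) _ _ _ (is_derive_pos_part_pow k _) dS).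
  have sint : 0 < sin t by rewrite sin_gt0_pi// t0.
  have dP := @is_derive_funcomp _ _ _ _ _ _
    (@is_derive_mul_pos_pow _ (2 * a - 2) _ sint) (is_derive_sin t).
  apply: is_derive_fun_eq (is_derive_funM (is_derive_const C t) (is_derive_funM dB
    dP)) _.
  rewrite /B mul0r add0r; congr (_ * (_ + _ * (_ * _ * _))); ring.
- move=> z zb; have [-> ->] := corner_max r c.
  rewrite /angular_field !space_part_set_max !angle_set_max sin0 sinpi.
  by rewrite !mul0r !mulr0 subrr.
Qed.

(** The total divergence depends on the second derivatives of [f] only through
its weighted Laplacian, and on the bump only through powers: the squared
gradient of s becomes 4 s after cos^2 + sin^2 = 1, and s is absorbed by
[bumpM]. *)
Lemma sum_divergence z : kernel_box r c z ->
  \sum_i space_divergence i z + angular_divergence z =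
  weight_ z * bump_ z ^+ k.+3 * weighted_laplacian a f (x_ z) -
  2 * k.+3%:R / r ^+ 2 *
    (2 * k.+2%:R * (weight_ z * bump_ z ^+ k.+1 * f (x_ z)) -
     (2 * k.+2%:R + (n%:R + 2 * a)) * (weight_ z * bump_ z ^+ k.+2 * f (x_ z))).
Proof.
move=> zb; have h0 := kernel_box_height zb.
rewrite big_split/= -mulr_sumr [X in _ + X + _](bigD1 ord_max)//= eqxx.
rewrite [X in _ + (_ + X) + _]big1 ?addr0; last by move=> i /negPf ->.
rewrite /weighted_laplacian /singular_term (gt_eqF h0).
rewrite /green_divergence sumrB -mulr_suml -mulr_sumr.
set lap := \sum_(i < n.+1) _.
set A := \sum_i (x_ z 0 i - c 0 i) ^+ 2.
set cs := cos (angle z); set sn := sin (angle z); set cy : R := c 0 ord_max.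
set y : R := h_ z in h0 *; set P := bump_ z.
have -> : \sum_(i < n.+1) (k.+3%:R * k.+2%:R * P ^+ k.+1 *
      (partial_sq_dist c i (x_ z) (angle z) / r ^+ 2) ^+ 2 -
      k.+3%:R * P ^+ k.+2 * (2 / r ^+ 2)) =
   k.+3%:R * k.+2%:R * P ^+ k.+1 *
     (4 * (A + 2 * y * cy * (1 - cs) - cy ^+ 2 * (1 - cs ^+ 2)) / r ^+ 4) -
   (n%:R + 1) * (k.+3%:R * P ^+ k.+2 * (2 / r ^+ 2)).
  have -> : \sum_(i < n.+1) (k.+3%:R * k.+2%:R * P ^+ k.+1 *
      (partial_sq_dist c i (x_ z) (angle z) / r ^+ 2) ^+ 2 -
      k.+3%:R * P ^+ k.+2 * (2 / r ^+ 2)) =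
    \sum_(i < n.+1) (k.+3%:R * k.+2%:R * P ^+ k.+1 * (4 / r ^+ 4) *
       (x_ z 0 i - c 0 i) ^+ 2 +
     (if i == ord_max then k.+3%:R * k.+2%:R * P ^+ k.+1 * (4 / r ^+ 4) *
       (2 * y * cy * (1 - cs) - cy ^+ 2 * (1 - cs ^+ 2)) else 0) -
      k.+3%:R * P ^+ k.+2 * (2 / r ^+ 2)).
    apply: eq_bigr => i _; congr (_ - _); rewrite /partial_sq_dist -/cs -/cy.
    by case: eqP => [->|_]; [rewrite -/y -/cy|rewrite !addr0]; field; rewrite gt_eqF.
  rewrite sumrB big_split/= -mulr_sumr -/A sumr_const card_ord -mulr_natl -natr1.
  rewrite (bigD1 ord_max)//= eqxx big1 => [|i /negPf -> //]; field.
  by rewrite gt_eqF.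
have PM := bumpM r c k (x_ z) (angle z).
rewrite -/P /sq_dist -/A -/y -/cy -/cs in PM.
rewrite /angular_divergence /green_field /partial_sq_dist eqxx /weight -/y -/cy -/cs
  -/sn -/P.
have := cos2Dsin2 (angle z); rewrite -/cs -/sn => trig.
move: PM; rewrite !(exprS P); set X := P ^+ k => PM.
set M := k.+3%:R; set M1 := k.+2%:R; set N : R := n%:R.
set Y := pos_pow _ y; set S := pos_pow _ sn; set F := f _; set F1 := partial _ _ _.
have rn : r != 0 by rewrite gt_eqF.
have yn : y != 0 by rewrite gt_eqF.
apply/eqP; rewrite -subr_eq0; apply/eqP.
transitivity (- (4 * M * M1 / r ^+ 2) * (y * Y * S) * F *
   (P * X * ((A + 2 * y * cy * (1 - cs)) / r ^+ 2) - (P * X - P * (P * X)))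
  - 4 * M * M1 * (y * Y * S) * F * P * X * cy ^+ 2 / r ^+ 4 * (cs ^+ 2 + sn ^+ 2 -
    1)).
  by field; apply/andP.
by rewrite PM trig !subrr !mulr0 subr0.
Qed.

Lemma green_identity :
  r ^+ 2 / (2 * k.+3%:R) * kernel_mean a r c k.+2 (weighted_laplacian a f) =
  2 * k.+2%:R * kernel_mean a r c k f -
  (2 * k.+2%:R + (n%:R + 2 * a)) * kernel_mean a r c k.+1 f.
Proof.
have lr := lt_corners r0 c0.
have [cf df] := fC.
have c1 := continuous_space_comp cf.
have c2 := continuous_space_comp (class_C_laplacian a (k := 0) fC fe).
have cB : continuous (fun z => bump_ z) by exact: continuous_bump.
have cw : continuous (fun z => weight_ z) by exact: continuous_weight.
have cD i : continuous (space_divergence i).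
  have [cG cD] := continuous_green i.
  have cy : continuous (fun z => hpow z) by exact: continuous_height_pow.
  have cs : continuous (fun z => spow z) by exact: continuous_sin_pow.
  apply: continuous_funD; first exact: continuous_funM.
  by case: eqP => _; solve_continuous.
have cT j g : continuous (fun z => g (x_ z)) ->
    continuous (fun z => weight_ z * bump_ z ^+ j * g (x_ z)).
  by move=> cg; solve_continuous.
pose A := 2 * k.+3%:R / r ^+ 2; pose B : R := 2 * k.+2%:R.
have : kmean (fun z => weight_ z * bump_ z ^+ k.+3 * weighted_laplacian a f (x_ z) -
    A * (B * (weight_ z * bump_ z ^+ k.+1 * f (x_ z)) -
     (B + (n%:R + 2 * a)) * (weight_ z * bump_ z ^+ k.+2 * f (x_ z)))) = 0.
  rewrite (eq_mean lr (G := fun z => \sum_i space_divergence i z + angular_divergence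
    z)).
    rewrite (meanD lr); [|exact: continuous_fun_sum
      |exact: continuous_angular_divergence].
    rewrite (mean_sum lr)// mean_angular_divergence addr0 big1// => i _.
    exact: mean_space_divergence.
  by move=> z /sum_divergence ->.
rewrite (meanB lr); [|exact: cT|by solve_continuous].
rewrite (meanZ lr); last by solve_continuous.
rewrite (meanB lr); [|by solve_continuous..].
rewrite !(meanZ lr); [|by solve_continuous..].
rewrite /kernel_mean => /eqP; rewrite subr_eq0 => /eqP ->.
have : (k.+3%:R : R) != 0 by rewrite pnatr_eq0.
rewrite /A /B; move: (k.+3%:R : R) => M M0.
by field; rewrite ?M0 ?gt_eqF.
Qed.

End GreenIdentity.

(** * Mean value inequality *)

Section MeanValueProperty.
Context {R : realType} {n : nat}.
Variables (a r : R) (c : 'rV[R]_n.+1).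
Hypotheses (a1 : 1 <= a) (r0 : 0 < r) (c0 : 0 <= c 0 ord_max).
Implicit Types (f g : 'rV[R]_n.+1 -> R) (z : 'rV[R]_n.+2) (k : nat).

Local Notation bump_ z := (bump r c (space_part z) (angle z)).
Local Notation weight_ z := (weight a (space_part z) (angle z)).
Local Notation km := (kernel_mean a r c).
Local Notation mass k := (kernel_mean a r c k (fun=> 1)).
Local Notation lr := (lt_corners r0 c0).

Lemma continuous_kernel_integrand k f : continuous f ->
  continuous (fun z => weight_ z * bump_ z ^+ k.+1 * f (space_part z)).
Proof.
move=> cf; have c1 := continuous_space_comp cf.
have cB : continuous (fun z => bump_ z) by exact: continuous_bump.
have cw : continuous (fun z => weight_ z) by exact: continuous_weight.
by solve_continuous.
Qed.

Lemma kernel_meanD k f g : continuous f -> continuous g ->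
  km k (fun x => f x + g x) = km k f + km k g.
Proof.
move=> cf cg; rewrite -(meanD lr); [|exact: continuous_kernel_integrand..].
by congr mean; apply/funext => z; rewrite mulrDr.
Qed.

Lemma kernel_meanZ k (l : R) f : continuous f ->
  km k (fun x => l * f x) = l * km k f.
Proof.
move=> cf; rewrite -(meanZ lr); last exact: continuous_kernel_integrand.
by congr mean; apply/funext => z; rewrite mulrCA.
Qed.

Lemma kernel_mean_cst k (l : R) : km k (fun=> l) = l * mass k.
Proof.
by rewrite -kernel_meanZ; [under [in RHS]eq_fun do rewrite mulr1
  |exact: cst_continuous].
Qed.

Lemma le_kernel_mean j k f g : continuous f -> continuous g ->
  (forall z, kernel_box r c z ->
     bump_ z ^+ j.+1 * f (space_part z) <= bump_ z ^+ k.+1 * g (space_part z)) ->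
  km j f <= km k g.
Proof.
move=> cf cg fg; apply: (le_mean lr); [exact: continuous_kernel_integrand..|].
move=> z zb; rewrite -2!mulrA; apply: ler_wpM2l; last exact: fg.
by apply: weight_ge0; exact/ltW/(kernel_box_height zb).
Qed.

Lemma kernel_mean_ge0 k f : continuous f -> (forall x, 0 <= f x) -> 0 <= km k f.
Proof.
move=> cf f0; rewrite -[leLHS](_ : km k (fun=> 0) = 0).
  apply: le_kernel_mean => //; first exact: cst_continuous.
  by move=> z _; rewrite mulr0 mulr_ge0// exprn_ge0// bump_ge0.
by rewrite kernel_mean_cst mul0r.
Qed.

Lemma kernel_meanS_le k f : continuous f -> (forall x, 0 <= f x) ->
  km k.+1 f <= km k f.
Proof.
move=> cf f0; apply: le_kernel_mean => // z zb.
rewrite ler_wpM2r// exprS ler_piMl ?exprn_ge0 ?bump_ge0// bump_le1//.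
by rewrite ltW// (kernel_box_height zb).
Qed.

(** The kernel is positive at a point slightly above the center, turned by a
small angle; both perturbations keep the weight from vanishing. *)
Lemma mass_gt0 k : 0 < mass k.
Proof.
have cF : continuous (fun z => weight_ z * bump_ z ^+ k.+1 * (1 : R)).
  by apply: (@continuous_kernel_integrand k (fun=> 1)); exact: cst_continuous.
pose y := c 0 ord_max + r / 2.
have y0 : 0 < y by rewrite ltr_wpDl// divr_gt0.
have [t [t0 tpi tr]] : exists t, [/\ 0 < t, t < pi &
    2 * y * c 0 ord_max * (1 - cos t) < r ^+ 2 / 2].
  have r2 : 0 < r ^+ 2 / 2 by rewrite divr_gt0// exprn_gt0.
  have cf : continuous (fun t : R => 2 * y * c 0 ord_max * (1 - cos t)).
    have := @continuous_cos R => ccos; solve_continuous.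
  have /nbhs_ballP[e /= e0 He] : \forall t \near (0 : R),
      2 * y * c 0 ord_max * (1 - cos t) < r ^+ 2 / 2.
    by apply: (cvgr_lt _ (cf 0)); rewrite cos0 subrr mulr0.
  exists (Num.min (e / 2) (pi / 2)); split.
  - by rewrite lt_min !divr_gt0// pi_gt0.
  - by rewrite gt_min; apply/orP; right; have := pi_gt0 R; lra.
  - apply: He; rewrite -ball_normE/= sub0r normrN ger0_norm.
      by rewrite gt_min; apply/orP; left; move: e0; lra.
    by rewrite le_min !divr_ge0 ?pi_ge0// ltW.
pose x := set_coord c ord_max y.
pose z0 : 'rV[R]_n.+2 := \row_j oapp (fun i => x 0 i) t (unlift ord_max j).
have xz0 : space_part z0 = x by apply/rowP => i; rewrite !mxE liftK/= mxE.
have az0 : angle z0 = t by rewrite /angle mxE unlift_none.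
apply: (@mean_gt0 _ _ _ _ lr _ z0 cF).
- move=> z zb; rewrite mulr1 mulr_ge0 ?exprn_ge0 ?bump_ge0 ?weight_ge0// ltW//.
  exact: (kernel_box_height zb).
- move=> j; rewrite !mxE; case: unliftP => [i _|_]/=; last by rewrite t0.
  rewrite mxE; case: eqP => [->|_]; first by rewrite y0 /y ltrD2l ltr_pdivrMr//
    ltr_pMr// ltr1n.
  by move: r0; lra.
rewrite mulr1 xz0 az0 /weight mxE eqxx !mulr_gt0 ?pos_pow_gt0 ?sin_gt0_pi ?t0//.
rewrite exprn_gt0// lt_max subr_gt0 ltr_pdivrMr ?exprn_gt0// mul1r orbC.
suff -> : sq_dist c x t = r ^+ 2 / 4 + 2 * y * c 0 ord_max * (1 - cos t).
  by apply/orP; left; move: tr r0; have : 0 < r ^+ 2 by [rewrite exprn_gt0]; lra.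
rewrite /sq_dist (bigD1 ord_max)//= big1 ?addr0.
  by rewrite mxE eqxx /y; field.
by move=> i /negPf ne; rewrite mxE ne subrr expr0n.
Qed.

Lemma massE k : 2 * k.+2%:R * mass k = (2 * k.+2%:R + (n%:R + 2 * a)) * mass k.+1.
Proof.
have pc i (l : R) : partial i (fun=> l) = (fun=> 0) :> ('rV[R]_n.+1 -> R).
  by apply/funext => x; exact: derive_cst.
have C1 j (l : R) : class_C j (fun _ : 'rV[R]_n.+1 => l).
  elim: j l => [|j IH] l; first exact: cst_continuous.
  split=> [|i]; first exact: cst_continuous.
  by split=> [x|]; [exact: derivable_cst|rewrite pc].
have := @green_identity R n a r c a1 r0 c0 k (fun=> 1) (C1 2 1) (fun=> erefl).
rewrite (_ : weighted_laplacian a _ = fun=> 0); last first.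
  apply/funext => x; rewrite /weighted_laplacian /singular_term big1 => [|i _].
    by rewrite !pc mulr0 if_same mulr0 addr0.
  by rewrite !pc.
by rewrite kernel_mean_cst mul0r mulr0 => /esym/eqP; rewrite subr_eq0 => /eqP.
Qed.

(** In the three-term relation the left-hand side is nonpositive, and the two
coefficients on the right are in the ratio of the masses. *)
Lemma kernel_mean_superharmonic k f : class_C 2 f -> even_last f ->
  (forall x, weighted_laplacian a f x <= 0) ->
  km k f / mass k <= km k.+1 f / mass k.+1.
Proof.
move=> fC fe Lf.
have cL : continuous (weighted_laplacian a f) := class_C_laplacian a (k := 0) fC fe.
have L0 : km k.+2 (weighted_laplacian a f) <= 0.
  have cN : continuous (fun x => -1 * weighted_laplacian a f x).
    by apply: continuous_funM => //; exact: cst_continuous.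
  have := kernel_mean_ge0 k.+2 cN (fun x => _).
  rewrite kernel_meanZ// mulN1r oppr_ge0; apply => x.
  by rewrite mulN1r oppr_ge0.
have := green_identity a1 r0 c0 k fC fe.
have c2 : 0 <= r ^+ 2 / (2 * k.+3%:R) :> R by rewrite divr_ge0// exprn_ge0// ltW.
move=> E; have : r ^+ 2 / (2 * k.+3%:R) * km k.+2 (weighted_laplacian a f) <= 0.
  by rewrite mulr_ge0_le0.
rewrite E subr_le0 => ineq.
rewrite ler_pdivrMr ?mass_gt0// mulrAC ler_pdivlMr ?mass_gt0//.
have Q0 : 0 < 2 * k.+2%:R + (n%:R + 2 * a) :> R.
  by rewrite addr_gt0 ?mulr_gt0// ltr_wpDl// mulr_gt0// (lt_le_trans ltr01).
rewrite -(ler_pM2l Q0) mulrCA -massE mulrA [leRHS]mulrA [_ * (2 * _)]mulrC.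
by rewrite ler_wpM2r// ltW// mass_gt0.
Qed.

(** The quotient of consecutive masses tends to 1, so the masses eventually
dominate any geometric sequence of ratio less than 1. *)
Lemma mass_beats_geometric (q d B : R) k0 : 0 <= q -> q < 1 -> 0 < d ->
  exists2 k, (k0 <= k)%N & B * q ^+ k < d * mass k.
Proof.
move=> q0 q1 d0; set Q : R := n%:R + 2 * a.
have Q0 : 0 < Q by rewrite ltr_wpDl// mulr_gt0// (lt_le_trans ltr01).
pose p := (1 + q) / 2.
have p0 : 0 < p by rewrite divr_gt0// ltr_wpDr.
have [qp p1] : q < p /\ p < 1 by move: q1; rewrite /p; lra.
have [K K0 HK] : exists2 K, (k0 <= K)%N &
    forall k, (K <= k)%N -> p * mass k <= mass k.+1.
  (* 2 (k + 2) / (2 (k + 2) + Q) >= p amounts to p Q / (1 - p) <= 2 (k + 2). *)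
  pose K := maxn k0 (Num.trunc (p * Q / (1 - p))).+1.
  exists K => [|k Kk]; first exact: leq_maxl.
  have kQ : p * Q / (1 - p) <= 2 * k.+2%:R.
    have : (Num.trunc (p * Q / (1 - p))).+1%:R <= k.+2%:R :> R.
      by rewrite ler_nat (leq_trans _ (leqW (leqW Kk)))// leq_maxr.
    have := truncnS_gt (p * Q / (1 - p)).
    have : 0 <= k.+2%:R :> R by [].
    set s := k.+2%:R; set t := _.+1%:R; set u := _ / _; lra.
  have k20 : 0 < 2 * k.+2%:R :> R by rewrite mulr_gt0.
  have kQ' : p * (2 * k.+2%:R + Q) <= 2 * k.+2%:R.
    by move: kQ; rewrite ler_pdivrMr ?subr_gt0//; lra.
  rewrite -(ler_pM2l k20) mulrCA massE mulrA.
  by apply: ler_wpM2r => //; rewrite ltW// mass_gt0.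
have HKj j : p ^+ j * mass K <= mass (K + j).
  elim: j => [|j IH]; first by rewrite expr0 mul1r addn0.
  rewrite exprS -mulrA addnS; apply: le_trans (HK (K + j)%N (leq_addr _ _)).
  by rewrite ler_wpM2l// ltW.
have qp1 : `|q / p| < 1.
  have qp0 : 0 <= q / p by rewrite divr_ge0// ltW.
  by rewrite (ger0_norm qp0) ltr_pdivrMr// mul1r.
have dK : 0 < d * mass K / (`|B| + 1).
  by rewrite divr_gt0 ?mulr_gt0 ?mass_gt0// ltr_wpDl.
have /(cvgr_lt 0)/(_ _ dK)[j0 _ /(_ j0 (leqnn _))] := cvg_expr qp1.
rewrite expr_div_n ltr_pdivrMr ?exprn_gt0// => Hj.
exists (K + j0)%N; first exact: leq_trans K0 (leq_addr _ _).
have B1 : 0 < `|B| + 1 by rewrite ltr_wpDl.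
apply: le_lt_trans (_ : (`|B| + 1) * q ^+ j0 < _).
  rewrite exprD mulrA ler_wpM2r ?exprn_ge0//.
  apply: le_trans (ler_norm _) _; rewrite normrM [`|q ^+ _|]ger0_norm ?exprn_ge0//.
  rewrite (le_trans (_ : _ <= `|B| * 1))//; last by rewrite mulr1 lerDl.
  by rewrite ler_wpM2l// exprn_ile1// ltW.
apply: lt_le_trans (_ : d * (p ^+ j0 * mass K) <= _); last by rewrite ler_wpM2l// ltW.
move: Hj; rewrite mulrAC ltr_pdivlMr// => Hj.
by rewrite mulrC (mulrC (p ^+ j0)) mulrA.
Qed.

(** Otherwise all later averages stay above f(c) + 2d with d > 0.  Points where
f >= f(c) + d lie at distance at least e from the center, where the bump is at
most some q < 1, so they contribute O(q^k), which is negligible against the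
total mass. *)
Lemma kernel_mean_le_center k f : class_C 2 f -> even_last f ->
  (forall x, weighted_laplacian a f x <= 0) ->
  km k f <= f c * mass k.
Proof.
move=> fC fe Lf; rewrite leNgt; apply/negP => lt_km.
have cf : continuous f := class_C_continuous fC.
(* Half of the excess of the average over the value at the center. *)
pose d := (km k f / mass k - f c) / 2.
have d0 : 0 < d by rewrite divr_gt0// subr_gt0 ltr_pdivlMr ?mass_gt0.
have fcd : f c + 2 * d = km k f / mass k.
  by rewrite /d; set t := km k f / _; lra.
have low j : (k <= j)%N -> (f c + 2 * d) * mass j <= km j f.
  move=> kj; rewrite -ler_pdivlMr ?mass_gt0// fcd.
  elim: j kj => [|j IH]; first by rewrite leqn0 => /eqP ->.
  rewrite leq_eqVlt => /predU1P[->//|/IH /le_trans]; apply.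
  exact: kernel_mean_superharmonic.
pose h x := f x - (f c + d).
have ch : continuous h by apply: continuous_funB => //; exact: cst_continuous.
have [M HM] := @continuous_bounded_box R _ (lower_corner r c)
  (upper_corner r c) _ (continuous_space_comp ch).
have /nbhs_ballP[e /= e0 He] : \forall x \near c, f x < f c + d.
  by apply: (cvgr_lt _ (cf c)); rewrite ltrDl.
pose q := Num.max 0 (1 - e ^+ 2 / r ^+ 2).
have q0 : 0 <= q by rewrite le_max lexx.
have q1 : q < 1.
  by rewrite gt_max ltr01 ltrBlDr ltrDl divr_gt0// exprn_gt0.
have [j kj] := mass_beats_geometric (M * mass 0) k q0 q1 d0.
rewrite ltNge => /negP; apply.
have M0 : 0 <= M.
  by apply: le_trans (HM (lower_corner r c) _) => // i; rewrite lexx ltW ?lr.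
have -> : M * mass 0 * q ^+ j = km 0 (fun=> M * q ^+ j).
  by rewrite [RHS]kernel_mean_cst mulrAC.
apply: (@le_trans _ _ (km j h)).
  rewrite (_ : km j h = km j f - (f c + d) * mass j).
    rewrite lerBrDr -mulrDl (_ : d + (f c + d) = f c + 2 * d); last by ring.
    exact: low.
  rewrite -[in RHS]kernel_mean_cst -[X in _ - X]mul1r -mulNr -kernel_meanZ;
    last exact: cst_continuous.
  rewrite -kernel_meanD//; last by apply: continuous_funM; exact: cst_continuous.
  by congr kernel_mean; apply/funext => x; rewrite mulN1r.
apply: le_kernel_mean => //; first exact: cst_continuous.
move=> z zb; have y0 := ltW (kernel_box_height zb).
have [lt_e|ge_e] := ltP (sq_dist c (space_part z) (angle z)) (e ^+ 2).
  apply: (@le_trans _ _ 0); last by rewrite !mulr_ge0// exprn_ge0// bump_ge0.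
  rewrite mulr_ge0_le0 ?exprn_ge0 ?bump_ge0// subr_le0 ltW// He//.
  split=> // i0 i; rewrite ord1 /ball/=.
  rewrite distrC -ltr_sqr ?nnegrE ?(ltW e0)// real_normK ?num_real//.
  by apply: le_lt_trans lt_e; exact: coord_sq_dist.
have bq : bump_ z <= q.
  rewrite ge_max !le_max lexx /= ?orbT lerD2l lerN2 ler_wpM2r ?invr_ge0 ?exprn_ge0
    ?(ltW r0)//.
  by rewrite orbT.
rewrite expr1 exprS -mulrA ler_wpM2l ?bump_ge0//.
apply: (@le_trans _ _ (bump_ z ^+ j * M)).
  rewrite ler_wpM2l ?exprn_ge0 ?bump_ge0//.
  by apply: le_trans (ler_norm _) (HM _ _); exact: sub_half_open_box.
by rewrite mulrC ler_wpM2l// lerXn2r ?nnegrE ?bump_ge0.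
Qed.

End MeanValueProperty.

(** * Minimum principle *)

Section MinimumPrinciple.
Context {R : realType}.

(** If f2 < 0, then f1 is negative just after t and f decreases below f(t). *)
Lemma second_derivative_at_min (f f1 : R -> R) (t f2 : R) :
  (forall s : R, is_derive s 1 f (f1 s)) -> is_derive t 1 f1 f2 ->
  (forall s, f t <= f s) -> f1 t = 0 /\ 0 <= f2.
Proof.
move=> df df1 ft.
have f1t : f1 t = 0.
  have [||||_ <-] := @derive1_at_min R f (t - 1) (t + 1) t.
  - by lra.
  - by move=> s _; have [] := df s.
  - by rewrite in_itv/=; apply/andP; split; lra.
  - by move=> s _; exact: ft.
  - by have [_ <-] := df t.
split=> //; rewrite leNgt; apply/negP => f2_lt0.
have [cf1 Df1] := df1.
have : \forall h \near 0^', h^-1 *: ((f1 \o shift t) (h *: (1 : R)) - f1 t) < 0.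
  by apply: (cvgr_lt f2) => //; rewrite -Df1; exact: cf1.
move=> /nbhs_ballP[e /= e0 He].
have e20 : 0 < e / 2 by rewrite divr_gt0.
have neg s : t < s -> s <= t + e / 2 -> f1 s < 0.
  move=> ts se; have st0 : 0 < s - t by rewrite subr_gt0.
  have /= := He (s - t) _ _; rewrite f1t subr0 [(s - t) *: _]mulr1 subrK.
  rewrite [_ *: _]/(_ * _) pmulr_rlt0 ?invr_gt0//; apply; last by rewrite gt_eqF.
  rewrite -ball_normE/= sub0r normrN gtr0_norm//.
  by move: se e0; lra.
have tt : t < t + e / 2 by rewrite ltrDl.
have [|s] := MVT tt (fun s _ => df s).
  apply: continuous_subspaceT => s.
  by apply/differentiable_continuous/derivable1_diffP; have [] := df s.
rewrite in_itv/= => /andP[ts se] E.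
have := ft (t + e / 2); rewrite -subr_ge0 E addrC addKr leNgt => /negP; apply.
by rewrite pmulr_llt0// neg// ltW.
Qed.

Context {n : nat}.

(** At a minimum the first-order term vanishes, or is a second derivative when
y = 0; the coefficient 2a - 1 is nonnegative. *)
Lemma laplacian_at_min (a : R) (f : 'rV[R]_n.+1 -> R) x : 1 <= a ->
  class_C 2 f -> (forall y, f x <= f y) -> 0 <= weighted_laplacian a f x.
Proof.
move=> a1 [_ df] fx.
have dE i : partial i f x = 0 /\ 0 <= partial i (partial i f) x.
  have [dfi [_ ddf]] := df i; have [ddfi _] := ddf i.
  have fmin s : f (set_coord x i (x 0 i)) <= f (set_coord x i s).
    by rewrite set_coord_id.
  have d2 := is_derive_partial x (x 0 i) ddfi.
  have [] := second_derivative_at_min (fun s => is_derive_partial x s dfi) d2 fmin.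
  by rewrite set_coord_id.
rewrite addr_ge0//; first by apply: sumr_ge0 => i _; have [] := dE i.
rewrite mulr_ge0//; first by move: a1; lra.
by rewrite /singular_term; have [-> ?] := dE ord_max; case: eqP => // _;
  rewrite mulr0.
Qed.

End MinimumPrinciple.

(** * Positivity of the iterates *)

Section Iterates.
Context {R : realType} {n : nat}.
Variables (a : R) (u : 'rV[R]_n.+1 -> R) (p : nat).
Hypotheses (uC : class_C (2 * p) u) (ue : even_last u).

Local Notation v i := (neg_weighted_laplacian_pow a i u).

Lemma iterate_regular i : (i <= p)%N ->
  class_C (2 * (p - i)) (v i) /\ even_last (v i).
Proof.
elim: i => [|i IH] ip; first by rewrite subn0.
have [vC ve] := IH (ltnW ip).
have kE : (2 * (p - i) = (2 * (p - i.+1)).+2)%N.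
  by rewrite -[in LHS](subnSK ip) mulnS.
rewrite kE in vC; have v2 : class_C 2 (v i) by apply: class_C_le vC.
rewrite /neg_weighted_laplacian_pow iterS -/(v i); split.
  rewrite (_ : (fun _ => _) = fun x => -1 * weighted_laplacian a (v i) x).
    by apply: class_CZ; exact: class_C_laplacian.
  by apply/funext => x; rewrite mulN1r.
by move=> x; rewrite even_laplacian.
Qed.

Lemma iterate_class_C2 i : (i < p)%N -> class_C 2 (v i).
Proof.
move=> ip; have [vC _] := iterate_regular (ltnW ip).
by apply: class_C_le vC; rewrite -[X in (X <= _)%N]/(2 * 1)%N leq_mul2l/= subn_gt0.
Qed.

Lemma iterate_even i : (i <= p)%N -> even_last (v i).
Proof. by move=> /iterate_regular[]. Qed.

Lemma continuous_iterate i : (i <= p)%N -> continuous (v i).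
Proof. by move=> /iterate_regular[/class_C_continuous]. Qed.

End Iterates.

Section Positivity.
Context {R : realType} {n : nat}.
Variables (a alpha : R) (u : 'rV[R]_n.+1 -> R) (p : nat).
Hypotheses (a1 : 1 <= a) (alpha1 : 1 < alpha) (p0 : (0 < p)%N).
Hypotheses (uC : class_C (2 * p) u) (ue : even_last u) (u0 : forall x, 0 < u x).
Hypothesis uE :
  forall x, neg_weighted_laplacian_pow a p u x = u x `^ alpha.

Local Notation v i := (neg_weighted_laplacian_pow a i u).
Local Notation mass r c k := (kernel_mean a r c k (fun=> 1)).

(** The radius grows while k is fixed, so averages with exponents k and 0 must be
comparable uniformly in it. *)
Lemma mass_ratio k : exists2 m : R, 0 < m &
  forall r (c : 'rV[R]_n.+1), 0 < r -> 0 <= c 0 ord_max -> mass r c k = m * mass r c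
    0.
Proof.
elim: k => [|k [m m0 IH]]; first by exists 1 => // r c _ _; rewrite mul1r.
have Q0 : 0 < 2 * k.+2%:R + (n%:R + 2 * a) :> R.
  by rewrite addr_gt0 ?mulr_gt0// ltr_wpDl// mulr_gt0// (lt_le_trans ltr01).
exists (2 * k.+2%:R * m / (2 * k.+2%:R + (n%:R + 2 * a))).
  by rewrite divr_gt0// !mulr_gt0.
move=> r c r0 c0; have := massE a1 r0 c0 k; rewrite IH// => E.
apply: (mulfI (lt0r_neq0 Q0)); rewrite -E.
by move: Q0; set q := _ + _ => q0; field; rewrite gt_eqF.
Qed.

(** Solving Green's identity for the term with L bounds the average of v_(i+1)
by r^(-2) times two averages of v_i, and the average of u with exponent j + 1
is at most the one with exponent j. *)
Lemma kernel_mean_iterate i : (i <= p)%N -> forall j, exists2 C : R, 0 <= C &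
  forall r (c : 'rV[R]_n.+1), 0 < r -> 0 <= c 0 ord_max ->
  `|kernel_mean a r c (j + 2 * i) (v i)| <= C / r ^+ (2 * i) * kernel_mean a r c j u.
Proof.
have cu : continuous u by exact: class_C_continuous uC.
have u_ge0 x : 0 <= u x by exact: ltW.
elim: i => [|i IH] ip j.
  exists 1 => // r c r0 c0; rewrite muln0 addn0 expr0 divr1 mul1r.
  by rewrite ger0_norm// kernel_mean_ge0.
have [C1 C10 H1] := IH (ltnW ip) j; have [C2 C20 H2] := IH (ltnW ip) j.+1.
set k := (j + 2 * i)%N; set Q : R := 2 * k.+2%:R + (n%:R + 2 * a).
have Q0 : 0 <= Q.
  by rewrite addr_ge0 ?mulr_ge0// addr_ge0// mulr_ge0// (le_trans ler01).
exists (2 * k.+3%:R * (2 * k.+2%:R * C1 + Q * C2)).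
  by rewrite !mulr_ge0// addr_ge0 ?mulr_ge0.
move=> r c r0 c0; set U := kernel_mean a r c j u.
have vC := iterate_class_C2 a uC ue ip; have ve := iterate_even a uC ue (ltnW ip).
have cL := class_C_laplacian a (k := 0) vC ve.
have U' : kernel_mean a r c j.+1 u <= U by exact: kernel_meanS_le.
have rj s : 0 < r ^+ s by rewrite exprn_gt0.
have G := green_identity a1 r0 c0 k vC ve.
have -> : (j + 2 * i.+1 = k.+2)%N by rewrite mulnS addnCA add2n.
rewrite (_ : v i.+1 = fun x => -1 * weighted_laplacian a (v i) x); last first.
  by apply/funext => x; rewrite mulN1r.
rewrite kernel_meanZ// mulN1r normrN.
have -> : kernel_mean a r c k.+2 (weighted_laplacian a (v i)) =
    2 * k.+3%:R / r ^+ 2 * (2 * k.+2%:R * kernel_mean a r c k (v i) -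
      Q * kernel_mean a r c k.+1 (v i)).
  have k3 : (k.+3%:R : R) != 0 by rewrite pnatr_eq0.
  rewrite -G; move: (k.+3%:R : R) k3 => K K0; field.
  by rewrite ?K0 ?gt_eqF.
rewrite normrM ger0_norm; last by rewrite divr_ge0// ?mulr_ge0// ltW.
have h1 : `|kernel_mean a r c k (v i)| <= C1 / r ^+ (2 * i) * U by exact: H1.
have h2 : `|kernel_mean a r c k.+1 (v i)| <= C2 / r ^+ (2 * i) * U.
  apply: le_trans (H2 r c r0 c0) _; rewrite ler_wpM2l// divr_ge0// ltW//.
have -> : 2 * k.+3%:R * (2 * k.+2%:R * C1 + Q * C2) / r ^+ (2 * i.+1) * U =
   2 * k.+3%:R / r ^+ 2 * (2 * k.+2%:R * (C1 / r ^+ (2 * i) * U) +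
     Q * (C2 / r ^+ (2 * i) * U)).
  rewrite mulnS exprD; field.
  by rewrite !gt_eqF.
rewrite ler_wpM2l//; first by rewrite divr_ge0// ?mulr_ge0// ltW.
apply: le_trans (ler_normB _ _) _; rewrite !normrM (ger0_norm Q0) (ger0_norm (_ : 0
  <= 2))//.
by rewrite (ger0_norm (_ : 0 <= k.+2%:R))// lerD// ler_wpM2l// mulr_ge0.
Qed.

(** Young's inequality with weights psi^j and psi^(j+2p).  Either
eps psi^(2p) t^(alpha-1) >= 1 and the first term dominates, or psi^j t is
bounded by the constant; the lower bound on j gives
psi^(j(alpha-1)) <= psi^(2p). *)
Lemma young_pointwise (j : nat) (eps psi t : R) :
  2 * p%:R / (alpha - 1) <= j%:R -> 0 < eps -> 0 <= psi -> psi <= 1 -> 0 < t ->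
  psi ^+ j.+1 * t <= eps * (psi ^+ (j + 2 * p).+1 * t `^ alpha) +
    (eps^-1) `^ ((alpha - 1)^-1) * psi.
Proof.
move=> jp eps0; rewrite le_eqVlt => /predU1P[<- _ t0|psi0 psi1 t0].
  by rewrite !expr0n/= !mul0r !mulr0 addr0.
have b0 : 0 < alpha - 1 by rewrite subr_gt0.
have a0 : 0 < alpha by rewrite (lt_trans ltr01).
have [big|small] := leP 1 (eps * psi ^+ (2 * p) * t `^ (alpha - 1)).
  apply: le_trans (_ : psi ^+ j.+1 * t * (eps * psi ^+ (2 * p) * t `^ (alpha - 1)) <=
    _).
    by rewrite ler_peMr// mulr_ge0 ?exprn_ge0// ltW.
  rewrite -(mulr_powRB1 (ltW t0) a0) -addSn exprD.
  rewrite [leLHS](_ : _ = eps * (psi ^+ j.+1 * psi ^+ (2 * p) * (t * t `^ (alpha -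
    1)))).
    by rewrite lerDl mulr_ge0 ?powR_ge0// ltW.
  by ring.
apply: (@le_trans _ _ ((eps^-1) `^ ((alpha - 1)^-1) * psi)); last first.
  by rewrite lerDr !mulr_ge0 ?powR_ge0 ?exprn_ge0// ltW.
rewrite exprSr mulrAC ler_wpM2r ?(ltW psi0)//.
have y0 : 0 <= psi ^+ j * t by rewrite mulr_ge0 ?exprn_ge0// ltW.
have -> : psi ^+ j * t = ((psi ^+ j * t) `^ (alpha - 1)) `^ (alpha - 1)^-1.
  by rewrite -powRrM mulfV ?gt_eqF// powRr1.
apply: ge0_ler_powR; rewrite ?nnegrE ?powR_ge0 ?invr_ge0 ?(ltW b0) ?(ltW eps0)//.
rewrite powRM ?exprn_ge0 ?(ltW psi0) ?(ltW t0)// -(powR_mulrn j (ltW psi0)) -powRrM.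
rewrite -div1r ler_pdivlMr// mulrC mulrA; apply: ltW; apply: le_lt_trans small.
rewrite ler_wpM2r ?powR_ge0// ler_wpM2l ?(ltW eps0)//.
rewrite -(powR_mulrn (2 * p) (ltW psi0)); apply: ger_powR; first by rewrite psi0.
by rewrite natrM -ler_pdivrMr.
Qed.

Lemma kernel_mean_young r (c : 'rV[R]_n.+1) (j : nat) (eps : R) :
  0 < r -> 0 <= c 0 ord_max ->
  2 * p%:R / (alpha - 1) <= j%:R -> 0 < eps ->
  kernel_mean a r c j u <= eps * kernel_mean a r c (j + 2 * p) (v p) +
    (eps^-1) `^ ((alpha - 1)^-1) * mass r c 0.
Proof.
move=> r0 c0 jp eps0; set K := _ `^ _.
have lr := lt_corners r0 c0.
have cv : continuous (v p) by exact: (continuous_iterate uC ue (leqnn p)).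
have cu : continuous u by exact: class_C_continuous uC.
have c1 : continuous (fun _ : 'rV[R]_n.+1 => 1 : R) by exact: cst_continuous.
have iu := @continuous_kernel_integrand R n a r c a1 j _ cu.
have iv := @continuous_kernel_integrand R n a r c a1 (j + 2 * p) _ cv.
have i1 := @continuous_kernel_integrand R n a r c a1 0 _ c1.
have cZ (e : R) (f : 'rV[R]_n.+2 -> R) : continuous f -> continuous (fun z :
  'rV[R]_n.+2 => e * f z).
  by move=> cf; apply: continuous_funM => //; exact: cst_continuous.
rewrite -(meanZ lr eps iv) -(meanZ lr K i1) -(meanD lr (cZ _ _ iv) (cZ _ _ i1)).
apply: (le_mean lr iu); first exact: continuous_funD (cZ _ _ iv) (cZ _ _ i1).
move=> z zb; have y0 := ltW (kernel_box_height zb).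
set w := weight _ _ _; set b := bump _ _ _ _; rewrite uE expr1 mulr1.
have w0 : 0 <= w by exact: weight_ge0.
rewrite [leRHS](_ : _ = w * (eps * (b ^+ (j + 2 * p).+1 * u (space_part z) `^ alpha)
  + K * b)); last by ring.
rewrite -mulrA ler_wpM2l// young_pointwise// ?bump_ge0// bump_le1//.
Qed.

(** In [kernel_mean_young] take eps = r^(2p) / (2C'), so that by
[kernel_mean_iterate] the first term is at most half of the left-hand side; the
other term is then of order r^(-2p/(alpha-1)). *)
Lemma kernel_mean_vanishes (j : nat) (delta : R) :
  2 * p%:R / (alpha - 1) <= j%:R -> 0 < delta ->
  exists2 r : R, 1 <= r & forall c : 'rV[R]_n.+1, 0 <= c 0 ord_max ->
    kernel_mean a r c j u <= delta * mass r c 0.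
Proof.
move=> jp d0; have [C C0 HC] := kernel_mean_iterate (leqnn p) j.
have b0 : 0 < alpha - 1 by rewrite subr_gt0.
have D0 : 0 < (delta / 2) `^ (alpha - 1) by rewrite powR_gt0// divr_gt0.
set D := _ `^ _ in D0.
pose C' := C + 1; have C'0 : 0 < C' by rewrite ltr_wpDl.
(* Since r <= r ^+ (2 * p), this makes eps^-1 at most D, hence the constant of
   Young's inequality at most delta / 2. *)
pose r := Num.max 1 (2 * C' / D).
have r1 : 1 <= r by rewrite le_max lexx.
have r0 : 0 < r by rewrite (lt_le_trans ltr01).
exists r => // c c0; set U := kernel_mean a r c j u; set m := mass r c 0.
have m0 : 0 < m by exact: mass_gt0.
have rp : 0 < r ^+ (2 * p) by rewrite exprn_gt0.
have U0 : 0 <= U.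
  by apply: kernel_mean_ge0 => //; [exact: class_C_continuous uC|move=> x;
    exact: ltW].
pose eps := r ^+ (2 * p) / (2 * C').
have eps0 : 0 < eps by rewrite divr_gt0// mulr_gt0.
have := kernel_mean_young r0 c0 jp eps0; rewrite -/U -/m.
set K := _ `^ _; set W := kernel_mean _ _ _ _ _.
have WU : eps * W <= U / 2.
  have W1 : W <= C' / r ^+ (2 * p) * U.
    apply: le_trans (ler_norm _) (le_trans (HC r c r0 c0) _).
    by rewrite ler_wpM2r// ler_wpM2r ?invr_ge0 ?(ltW rp)// lerDl.
  apply: le_trans (ler_wpM2l (ltW eps0) W1) _.
  rewrite le_eqVlt; apply/orP; left; apply/eqP; rewrite /eps.
  by move: rp; set q := r ^+ _ => q0; field; rewrite !gt_eqF.
have Kd : K <= delta / 2.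
  have -> : delta / 2 = D `^ (alpha - 1)^-1.
    by rewrite /D -powRrM mulfV ?gt_eqF// powRr1// divr_ge0// ltW.
  apply: ge0_ler_powR; rewrite ?nnegrE ?invr_ge0 ?(ltW b0) ?(ltW eps0) ?(ltW D0)//.
  rewrite /eps invf_div ler_pdivrMr// [leRHS]mulrC -ler_pdivrMr//.
  have rm : 2 * C' / D <= r by rewrite le_max lexx orbT.
  apply: (le_trans rm).
  rewrite -[leLHS]expr1; apply: ler_weXn2l => //.
  by rewrite muln_gt0.
move=> H; have Km : K * m <= delta / 2 * m by rewrite ler_wpM2r// ltW.
by move: H WU Km; lra.
Qed.

(** The average of v_i is at most a fixed multiple of v_i(c) < 0 and at least
-C delta; delta is chosen so that these contradict each other. *)
Lemma iterate_ge0_upper i (c : 'rV[R]_n.+1) : (i < p)%N -> 0 <= c 0 ord_max ->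
  (forall x, 0 <= v i.+1 x) -> 0 <= v i c.
Proof.
move=> ip c0 v1; rewrite leNgt; apply/negP => vc.
have vC := iterate_class_C2 a uC ue ip; have ve := iterate_even a uC ue (ltnW ip).
have Lv x : weighted_laplacian a (v i) x <= 0 by rewrite -oppr_ge0; exact: v1.
pose j := (Num.trunc (2 * p%:R / (alpha - 1))).+1.
have jp : 2 * p%:R / (alpha - 1) <= j%:R by rewrite ltW// truncnS_gt.
have [C C0 HC] := kernel_mean_iterate (ltnW ip) j.
have [m m0 Hm] := mass_ratio (j + 2 * i).
pose delta := - v i c * m / (2 * (C + 1)).
have C1 : 0 < C + 1 by rewrite ltr_wpDl.
have d0 : 0 < delta by rewrite divr_gt0 ?mulr_gt0 ?oppr_gt0.
have [r r1 /(_ c c0) Hr] := kernel_mean_vanishes jp d0.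
have r0 : 0 < r by rewrite (lt_le_trans ltr01).
have M0 : 0 < mass r c 0 by exact: mass_gt0.
have U0 : 0 <= kernel_mean a r c j u.
  by apply: kernel_mean_ge0 => //; [exact: class_C_continuous uC|move=> x;
    exact: ltW].
have := kernel_mean_le_center a1 r0 c0 (j + 2 * i) vC ve Lv.
rewrite Hm//; apply/negP; rewrite -ltNge.
have low : - (C * (delta * mass r c 0)) <= kernel_mean a r c (j + 2 * i) (v i).
  rewrite lerNl; apply: le_trans (ler_norm _) _; rewrite normrN.
  apply: le_trans (HC r c r0 c0) _.
  apply: (@le_trans _ _ (C * kernel_mean a r c j u)); last by rewrite ler_wpM2l.
  rewrite ler_wpM2r// ler_pdivrMr ?exprn_gt0// ler_peMr//.
  by rewrite exprn_ege1.
apply: lt_le_trans low; rewrite ltrNr -mulNr [ltLHS]mulrA [ltRHS]mulrA ltr_pM2r//.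
have -> : - v i c * m = 2 * (C + 1) * delta by rewrite /delta; field; rewrite gt_eqF.
by rewrite ltr_pM2r//; move: C0; lra.
Qed.

Lemma iterate_ge0 i : (i < p)%N -> (forall x, 0 <= v i.+1 x) -> forall x, 0 <= v i x.
Proof.
move=> ip v1 x; have [x0|x0] := leP 0 (x 0 ord_max); first exact: iterate_ge0_upper.
rewrite -(iterate_even a uC ue (ltnW ip)); apply: iterate_ge0_upper => //.
by rewrite mxE eqxx oppr_ge0 ltW.
Qed.

Lemma iterate_gt0_step i : (i < p)%N -> (forall x, 0 < v i.+1 x) ->
  forall x, 0 < v i x.
Proof.
move=> ip v1 x; have v0 := iterate_ge0 ip (fun x => ltW (v1 x)).
rewrite lt_neqAle v0 andbT eq_sym; apply/eqP => vx.
have vC := iterate_class_C2 a uC ue ip.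
have := laplacian_at_min a1 vC (x := x); rewrite vx => /(_ v0).
by apply/negP; rewrite -ltNge -oppr_gt0; exact: v1.
Qed.

Lemma iterate_gt0 i : (i <= p)%N -> forall x, 0 < v i x.
Proof.
move=> /subKn <-; elim: (p - i)%N => [|d IH] x; first by rewrite subn0 uE powR_gt0.
have [dp|pd] := ltnP d p; last first.
  by rewrite (eqP (_ : p - d.+1 == 0)%N) ?subn_eq0 1?ltnW//; exact: u0.
apply: iterate_gt0_step; first by rewrite -subn_gt0 subKn.
by move=> y; rewrite subnSK.
Qed.

End Positivity.

Theorem theorem1p2 (R : realType) (n p : nat) (a alpha : R)
    (u : 'rV[R]_n.+1 -> R) :
  (1 <= n)%N -> (1 <= p)%N ->
  1 <= a -> (2 * p)%:R < n%:R + 2 * a -> 1 < alpha ->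
  class_C (2 * p) u ->
  (forall x, 0 < u x) ->
  even_last u ->
  (forall x, neg_weighted_laplacian_pow a p u x = u x `^ alpha) ->
  forall i : nat, (1 <= i <= p - 1)%N ->
  forall x, 0 < neg_weighted_laplacian_pow a i u x.
Proof.
move=> _ p1 a1 _ alpha1 uC u0 ue uE i /andP[_ ip].
by apply: (iterate_gt0 a1 alpha1 p1 uC ue u0 uE); rewrite (leq_trans ip)// leq_subr.
Qed.
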